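(* Let $S\subset\mathbb{P}^1(\mathbf{k}_\infty)$ be a nonempty open compact subset. (1) Let $l$ be a sufficiently large integer. A functional $\mu\in(P_l^{(\infty)})^*=\mathrm{Hom}_{\mathbf{C}_\infty}(P_l^{(\infty)},\mathbf{C}_\infty)$ can be extended to an element of $(LA_l(S))^*$ if and only if $$\left|\int_{B_a(|\pi|^l)}\chi(a,l;j;x)\,d\mu(x)\right|=\left|\int_S\chi(a,l;j;x)\,d\mu(x)\right|\le C\cdot|\pi|^{lj}$$ for any $j\ge0$ and any $B_a(|\pi|^l)\subset S$, where $C$ is a constant depending only on $\mu$. (2) A functional $\mu\in(P^{(\infty)})^*=\mathrm{Hom}_{\mathbf{C}_\infty}(P^{(\infty)},\mathbf{C}_\infty)$ can be extended to an element of $(LA(S))^*$ if and only if $$\left|\int_{B_a(|\pi|^l)}\chi(a,l;j;x)\,d\mu(x)\right|=\left|\int_S\chi(a,l;j;x)\,d\mu(x)\right|\le C(l)\cdot|\pi|^{lj}$$ for any sufficiently large integer $l$, any $j\ge0$, and any $B_a(|\pi|^l)\subset S$, where $C(l)$ is a constant depending only on $l$ and $\mu$.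
   Context: Let $q$ be a power of a prime $p$, $\pi=1/T$, $\mathbf{k}_\infty=\mathbb{F}_q((\pi))$ with $|\pi|=1/q$, and $\mathbf{C}_\infty$ the completion of an algebraic closure of $\mathbf{k}_\infty$. For a topological vector space $M$ over $\mathbf{C}_\infty$, $M^*$ is the space of continuous $\mathbf{C}_\infty$-linear maps $M\to\mathbf{C}_\infty$. Write $\int_Sf\,d\mu=\mu(f)$, and for open compact $U\subset S$, $\int_Uf\,d\mu=\int_Sf\,\xi_U\,d\mu$ with $\xi_U$ the characteristic function of $U$. Balls. For $a\in\mathbf{k}_\infty$, $B_a(|\pi|^l)=\{x\in\mathbf{k}_\infty:|x-a|\le|\pi|^l\}$; $B_\infty(|\pi|^l)=\{x\in\mathbf{k}_\infty:|x|\ge|\pi|^{-l}\}\cup\{\infty\}$, viewed as the closed ball of radius $|\pi|^l$ centered at $\infty$. Functions. For integers $l,j\ge0$ and $a\in S$, $a\ne\infty$, with $B_a(|\pi|^l)\subset S$, $\chi(a,l;j;x)=(x-a)^j$ if $x\in B_a(|\pi|^l)$ and $0$ otherwise. If $a=\infty$ and $B_\infty(|\pi|^l)\subset S$, $\chi(\infty,l;j;x)=(1/x)^j$ if $x\in B_\infty(|\pi|^l)$ and $0$ otherwise. $P_l^{(n)}$ is the $\mathbf{C}_\infty$-vector space spanned by all $\chi(a,l;j;x)$ with $a\in S$, $0\le j\le n$; $P_l^{(\infty)}=\varinjlim_nP_l^{(n)}$; $P^{(n)}=\varinjlim_lP_l^{(n)}$; and $P^{(\infty)}=\varinjlim_nP^{(n)}$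 is the space of all locally polynomial functions on $S$. Locally analytic functions. A function on $B_a(|\rho|)$, $a\in\mathbf{k}_\infty$, is analytic if it equals $\sum_{n\ge0}c_n\left(\frac{x-a}{\rho}\right)^n$ with $c_n\in\mathbf{C}_\infty$, $c_n\to0$; a function $f$ on $B_\infty(|\rho|)$ is analytic if $g(x)=f(1/x)$ is analytic on $B_0(|\rho|)$. $LA(S)$ is the space of functions $f:S\to\mathbf{C}_\infty$ that are, at every $a\in S$, analytic on some closed ball of positive radius centered at $a$; $LA_l(S)$ is the space of those for which this ball can be taken of radius at least $|\pi|^l$ at every $a\in S$. Here $l$ is always assumed sufficiently large (for instance $|\pi|^l$ at most the smallest radius in a decomposition of $S$ into finitely many disjoint closed balls of positive radii). $LA_l(S)$ is a Banach space: decompose $S=\bigsqcup_iB_i$ into finitely many closed balls of radius $|\pi|^l$; for $f\in LA_l(S)$ expand $f|_{B_i}(x)=\sum_{n\ge0}c_{in}\left(\frac{x-a_i}{\pi^l}\right)^n$, $a_i\in B_i$ (if $B_i$ is the ball centered at $\infty$, expand instead $g_i(x)=f|_{B_i}(1/x)=\sum_{n\ge0}c_{in}\left(\frac{x}{\pi^l}\right)^n$), and set $\|f\|=\max_i\max_n|c_{in}|$. $LA(S)=\varinjlim LA_l(S)=\bigcup_lLA_l(S)$ carries the direct limit topology: a map on $LA(S)$ is continuous iff its restriction to $LA_l(S)$ is continuous for each sufficiently large $l$.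
   Formalization: If ∞∈S the claim fails as written; then finite centres a with |a|≥|π|^{-l} are excluded, P^(∞) is the space of functions lying in P_l^(n) for some n and all large l (constant near ∞), and the bound in (2) omits χ(∞,l;j), j>0, which are not in P^(∞). *)

(* Defs.v *)
From HB Require Import structures.
From mathcomp Require Import all_boot all_order all_algebra.
From mathcomp Require Import all_classical all_reals all_analysis.

Set Implicit Arguments.
Unset Strict Implicit.
Unset Printing Implicit Defensive.
Import Order.TTheory GRing.Theory Num.Theory.
Local Open Scope classical_set_scope.
Local Open Scope ring_scope.

Import numFieldNormedType.Exports.

(* A field with a nonarchimedean absolute value.  The library's normed types
   do not apply: [normedZmodType] forces characteristic 0. *)
Record ultrametricFieldType (R : realType) : Type := UltrametricFieldType {
  ultra_field :> fieldType;
  absv : ultra_field -> R;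
  absv_ge0 : forall x, 0 <= absv x;
  absv_eq0 : forall x, (absv x == 0) = (x == 0);
  absvM : forall x y, absv (x * y) = absv x * absv y;
  absvD_le : forall x y, absv (x + y) <= Num.max (absv x) (absv y)
}.

Section Convergence.
Variables (R : realType) (K : ultrametricFieldType R).

Definition cvg_abs (u : nat -> K) (x : K) : Prop :=
  (fun n => absv (u n - x)) @ \oo --> (0 : R).

Definition complete_abs : Prop := forall u : nat -> K,
  (forall e : R, 0 < e ->
     exists N, forall m n, (N <= m)%N -> (N <= n)%N -> absv (u m - u n) < e) ->
  exists x, cvg_abs u x.

Definition dense_abs (A : set K) : Prop :=
  forall (z : K) (e : R), 0 < e -> exists2 y, A y & absv (z - y) < e.

End Convergence.

(* [k], with constants [cst : F -> k] and uniformizer [pi], is the field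
   F((pi)) of formal Laurent series with its absolute value: every formal
   Laurent series \sum_n c_n pi^(m+n) has a value in k and every element of k
   is such a value.  The absolute value makes the expansion unique up to
   leading zeros, so this determines (k, pi, absv) up to isomorphism. *)
Definition is_Laurent_series_field (R : realType) (F : finFieldType)
    (k : ultrametricFieldType R) (cst : {rmorphism F -> k}) (pi : k) : Prop :=
  let value m (c : nat -> F) (x : k) :=
    cvg_abs (series (fun n : nat => cst (c n) * pi ^ (m + n%:Z))) x in
  [/\ absv pi = #|F|%:R^-1,
      forall (m : int) (c : nat -> F), exists x : k, value m c x &
      forall x : k, exists (m : int) (c : nat -> F), value m c x].

Definition is_completion_of_algebraic_closure (R : realType)
    (k C : ultrametricFieldType R) (iota : {rmorphism k -> C}) : Prop :=
  [/\ forall x : k, absv (iota x) = absv x,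
      complete_abs C &
      exists (L : closedFieldType) (i : {rmorphism k -> L})
             (j : {rmorphism L -> C}),
        [/\ forall x : k, j (i x) = iota x,
            forall u : L, algebraicOver i u &
            dense_abs (range j)]].

(* The projective line k \cup {oo}; [None] is the point at infinity. *)
Definition P1 (R : realType) (k : ultrametricFieldType R) : Type := option k.

HB.instance Definition _ (R : realType) (k : ultrametricFieldType R) :=
  Choice.on (P1 k).

Definition cball (R : realType) (k : ultrametricFieldType R)
    (a : P1 k) (r : R) : set (P1 k) :=
  fun x => match a, x with
  | Some a', Some x' => absv (x' - a') <= r
  | Some _, None => False
  | None, Some x' => r^-1 <= absv x'
  | None, None => True
  end.

Section P1_topology.
Variables (R : realType) (k : ultrametricFieldType R).

Definition P1_open (U : set (P1 k)) : Prop :=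
  forall a, U a -> exists2 r : R, 0 < r & cball a r `<=` U.

Lemma cball_le (a : P1 k) (r s : R) :
  0 < r -> r <= s -> cball a r `<=` cball a s.
Proof.
move=> r0 rs [x|] /=; case: a => [a|] //=; first by move/le_trans; apply.
by apply: le_trans; rewrite lef_pV2 // posrE ?(lt_le_trans r0 rs).
Qed.

Lemma P1_openT : P1_open setT.
Proof. by move=> a _; exists 1. Qed.

Lemma P1_openI : setI_closed P1_open.
Proof.
move=> U V oU oV a [/oU[r r0 rU] /oV[s s0 sV]].
exists (Num.min r s); first by rewrite lt_min r0 s0.
move=> x ax; split.
- by apply/rU/(cball_le _ _ ax); rewrite ?lt_min ?r0 ?s0 ?ge_min ?lexx.
- by apply/sV/(cball_le _ _ ax); rewrite ?lt_min ?r0 ?s0 ?ge_min ?lexx ?orbT.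
Qed.

Lemma P1_open_bigU (I : Type) (f : I -> set (P1 k)) :
  (forall i, P1_open (f i)) -> P1_open (\bigcup_i f i).
Proof.
move=> of_ a [i _ /(of_ i)[r r0 rf]]; exists r => // x /rf fx.
by exists i.
Qed.

HB.instance Definition _ :=
  isOpenTopological.Build (P1 k) P1_openT P1_openI P1_open_bigU.

End P1_topology.

Definition linear_span (K : pzRingType) (X : Type) (G : set (X -> K))
    : set (X -> K) :=
  [set f | exists (n : nat) (c : 'I_n -> K) (g : 'I_n -> X -> K),
     (forall i, G (g i)) /\ f = fun x => \sum_(i < n) c i * g i x].

(* Hom(D, K) for a linear subspace D of K^X; the values of mu off D are
   irrelevant. *)
Definition linear_on (K : pzRingType) (X : Type) (D : set (X -> K))
    (mu : (X -> K) -> K) : Prop :=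
  forall (c : K) (f g : X -> K), D f -> D g ->
    mu (fun x => c * f x + g x) = c * mu f + mu g.

Definition extends (K V : Type) (D : set V) (nu mu : V -> K) : Prop :=
  forall f, D f -> nu f = mu f.

Section LocallyAnalytic.
Variables (R : realType) (k C : ultrametricFieldType R).
Variables (pi : k) (iota : {rmorphism k -> C}) (S : set (P1 k)).

(* x - a at a finite point a, and 1/x (which is 0 at oo) at a = oo; the value
   at x = oo for finite a is never used. *)
Definition local_coord (a x : P1 k) : k :=
  match a, x with
  | Some a', Some x' => x' - a'
  | None, Some x' => x'^-1
  | _, None => 0
  end.

Definition ballpi (a : P1 k) (l : nat) : set (P1 k) := cball a (absv pi ^+ l).

(* The balls of radius |pi|^l contained in S.  When oo \in S, the ball of
   radius |pi|^l around a finite point a of B_oo(|pi|^l) is B_oo(|pi|^l), so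
   its centre has to be oo: with this proviso these are exactly the balls
   occurring in the decompositions of S into closed balls of radius |pi|^l. *)
Definition is_centre (l : nat) (a : P1 k) : Prop :=
  ballpi a l `<=` S /\ (S None -> a = None \/ ~ ballpi None l a).

Definition chi (a : P1 k) (l j : nat) : S -> C :=
  fun x => if sval x \in ballpi a l then iota (local_coord a (sval x)) ^+ j
           else 0.

Definition Pln (l n : nat) : set (S -> C) :=
  linear_span [set f | exists a j, [/\ is_centre l a, (j <= n)%N &
                                       f = chi a l j]].

Definition Plinf (l : nat) : set (S -> C) := \bigcup_n Pln l n.

(* The direct limit over l of the P_l^(n) along inclusions.  If oo \notin S
   then P_l^(n) `<=` P_(l+1)^(n) and this is the union over l.  If oo \in S the
   inclusion fails for chi(oo,l;j), j > 0, because 1/x^j is not locally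
   polynomial in x on |x| = |pi|^-l; the limit then consists of the functions
   that stay in P_l^(n) as l grows. *)
Definition Pn (n : nat) : set (S -> C) :=
  [set f | \forall l \near \oo, Pln l n f].

Definition Pinf : set (S -> C) := \bigcup_n Pn n.

Definition expansion (f : S -> C) (a : P1 k) (rho : k) (c : nat -> C) : Prop :=
  cvg_abs c 0 /\
  forall x : S, cball a (absv rho) (sval x) ->
    cvg_abs (series (fun n => c n * iota (local_coord a (sval x) / rho) ^+ n))
      (f x).

Definition analytic_on_ball (f : S -> C) (a : P1 k) (rho : k) : Prop :=
  cball a (absv rho) `<=` S /\ exists c, expansion f a rho c.

Definition LA : set (S -> C) :=
  [set f | forall a, S a -> exists2 rho, rho != 0 & analytic_on_ball f a rho].

Definition LAl (l : nat) : set (S -> C) :=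
  [set f | forall a, S a ->
     exists2 rho, absv pi ^+ l <= absv rho & analytic_on_ball f a rho].

Definition ball_decomposition (l : nat) (D : seq (P1 k)) : Prop :=
  S = \bigcup_(a in [set` D]) ballpi a l /\
  trivIset [set` D] (fun a => ballpi a l).

(* max_i max_n |c_in|; the coefficients on each ball are unique, and the
   supremum over n is attained since they tend to 0. *)
Definition LAl_norm (l : nat) (D : seq (P1 k)) (f : S -> C) : R :=
  \big[Num.max/0]_(a <- D)
    sup [set r | exists c n, expansion f a (pi ^+ l) c /\ r = absv (c n)].

Definition LAl_continuous (l : nat) (nu : (S -> C) -> C) : Prop :=
  exists2 D, ball_decomposition l D &
    forall f, LAl l f -> forall e : R, 0 < e -> exists2 d : R, 0 < d &
      forall g, LAl l g -> LAl_norm l D (fun x => g x - f x) < d -> absv (nu g - nu f) < e.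

Definition LAl_dual (l : nat) : set ((S -> C) -> C) :=
  [set nu | linear_on (LAl l) nu /\ LAl_continuous l nu].

Definition LA_dual : set ((S -> C) -> C) :=
  [set nu | linear_on LA nu /\ \forall l \near \oo, LAl_continuous l nu].

Definition integral (mu : (S -> C) -> C) (f : S -> C) : C := mu f.

Definition integral_over (U : set (P1 k)) (mu : (S -> C) -> C) (f : S -> C)
  : C := integral mu (fun x => f x * \1_U (sval x)).

(* The growth condition at level l, over those chi(a,l;j) on which mu is
   defined, i.e. which belong to its domain P.  *)
Definition growth_bound (P : set (S -> C)) (l : nat) (mu : (S -> C) -> C)
    (M : R) : Prop :=
  forall (j : nat) (a : P1 k), is_centre l a -> P (chi a l j) ->
    absv (integral_over (ballpi a l) mu (chi a l j))
      = absv (integral mu (chi a l j)) /\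
    absv (integral mu (chi a l j)) <= M * absv pi ^+ (l * j).

End LocallyAnalytic.

Arguments Plinf {R k C} pi iota S l.
Arguments Pinf {R k C} pi iota S.
Arguments LAl_dual {R k C} pi iota S l.
Arguments LA_dual {R k C} pi iota S.
Arguments growth_bound {R k C} pi iota {S} P l mu M.

(* Main.v *)
From HB Require Import structures.
Require Import Defs.
From mathcomp Require Import all_boot all_order all_algebra.
From mathcomp Require Import all_classical all_reals all_analysis.
From mathcomp Require Import ring zify.

Set Implicit Arguments.
Unset Strict Implicit.
Unset Printing Implicit Defensive.
Import Order.TTheory GRing.Theory Num.Theory.
Local Open Scope classical_set_scope.
Local Open Scope ring_scope.
Import numFieldNormedType.Exports.

(* A function in LA_l(S) is determined by its Taylor coefficients on the balls
   of a decomposition D of S, and any bounded family of weights w(a, n) gives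
   the continuous functional f |-> \sum_(a in D) \sum_n c_(a,n) w(a,n).  For (1)
   take w(a, n) = mu(chi(a,l;n)) / pi^(l n).

   For (2) the same functionals at successive levels must be compatible on
   LA_l(S).  At finite centres this is forced by finite additivity and density
   of the polynomials.  At oo the value b_n(l) on chi(oo,l;n), n > 0, is not
   determined by mu, as 1/x^n is not locally polynomial on the shell
   |x| = |pi|^-l; compatibility reads b_n(l) = b_n(l+1) + s_n(l), where s_n(l) is
   the contribution of the shell.  A Mittag-Leffler argument solves this with
   b_n(l) = O_l(|pi|^(l n)).  The functional obtained extends mu because an
   element of P^(oo) is constant near oo: a polynomial in 1/x which agrees with
   a polynomial in x at infinitely many points is constant. *)

(** * Nonarchimedean null sequences and their sums *)

(** Two facts carry the estimates. Substituting a power series with coefficients of size at most 1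
    into another one does not enlarge the bound on the coefficients; every change of centre, even
    from oo to a finite point, is such a substitution, so the norm of a function does not increase
    with the level. And chi(a,l;j) has norm at most |pi|^(l j): dividing by pi^(l j) therefore turns
    the growth condition into boundedness of the weights, and rescaling chi by powers of pi recovers
    the growth condition from continuity. The obstacle in (2) is that C(l) may grow with l without
    any control. The shells satisfy only |s_n(i)| <= C(i+1) |pi|^(i n), so the sum of s_n(i) over i
    >= l need not converge and cannot serve as b_n(l). But the recursion leaves b_n(0) free for each
    n, and this freedom is what the Mittag-Leffler argument exploits. *)

Section AbsoluteValue.
Variables (R : realType) (K : ultrametricFieldType R).
Implicit Types (x y : K) (r : R).

Lemma absv0 : absv (0 : K) = 0.
Proof. by apply/eqP; rewrite absv_eq0. Qed.

Lemma absv_gt0 x : (0 < absv x) = (x != 0).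
Proof. by rewrite lt_def absv_ge0 andbT absv_eq0. Qed.

Lemma absv1 : absv (1 : K) = 1.
Proof.
have n0 : absv (1 : K) != 0 by rewrite absv_eq0 oner_eq0.
by apply: (mulfI n0); rewrite -absvM !mulr1.
Qed.

Lemma absvX x n : absv (x ^+ n) = absv x ^+ n.
Proof. by elim: n => [|n IH]; rewrite ?expr0 ?absv1 // !exprS absvM IH. Qed.

Lemma absvN x : absv (- x) = absv x.
Proof.
apply/eqP; rewrite -(@eqrXn2 _ 2%N) ?absv_ge0 //.
by rewrite -!absvX sqrrN.
Qed.

Lemma absvV x : absv x^-1 = (absv x)^-1.
Proof.
have [->|x0] := eqVneq x 0; first by rewrite invr0 absv0 invr0.
have n0 : absv x != 0 by rewrite absv_eq0.
by apply: (mulfI n0); rewrite -absvM !mulfV // absv1.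
Qed.

Lemma absv_add_le x y r : absv x <= r -> absv y <= r -> absv (x + y) <= r.
Proof.
by move=> xr yr; apply: le_trans (absvD_le x y) _; rewrite ge_max xr yr.
Qed.

Lemma absv_sub_le x y r : absv x <= r -> absv y <= r -> absv (x - y) <= r.
Proof. by move=> xr yr; apply: absv_add_le; rewrite ?absvN. Qed.

Lemma absv_subC x y : absv (x - y) = absv (y - x).
Proof. by rewrite -opprB absvN. Qed.

Lemma absv_dist_le y x z r :
  absv (x - y) <= r -> absv (y - z) <= r -> absv (x - z) <= r.
Proof.
by move=> xy yz; rewrite -(subrK y x) -addrA; apply: absv_add_le.
Qed.

Lemma absv_sum_le (I : Type) (s : seq I) (P : pred I) (f : I -> K) r :
  0 <= r -> (forall i, P i -> absv (f i) <= r) ->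
  absv (\sum_(i <- s | P i) f i) <= r.
Proof.
move=> r0 fr; apply: (big_ind (fun z => absv z <= r)) => //.
- by rewrite absv0.
- by move=> x y; apply: absv_add_le.
Qed.

Lemma absv_small_eq x : (forall r, 0 < r -> absv x <= r) -> x = 0.
Proof.
move=> H; apply/eqP; rewrite -absv_eq0 eq_le absv_ge0 andbT.
by apply/ler_addgt0Pl => e e0; rewrite addr0 H.
Qed.

End AbsoluteValue.

Section NullSequences.
Variables (R : realType) (K : ultrametricFieldType R).
Implicit Types (c d : nat -> K) (x y : K) (r : R).

Lemma cvg_absP (u : nat -> K) x :
  cvg_abs u x <->
  (forall r, 0 < r -> exists N, forall n, (N <= n)%N -> absv (u n - x) <= r).
Proof.
split.
- move=> /cvgrPdist_le H r r0; have [N _ HN] := H r r0.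
  by exists N => n /HN; rewrite /= sub0r normrN ger0_norm ?absv_ge0.
- move=> H; apply/cvgrPdist_le => r r0; have [N HN] := H r r0.
  by exists N => // n /HN; rewrite /= sub0r normrN ger0_norm ?absv_ge0.
Qed.

Lemma cvg_abs_unique (u : nat -> K) x y : cvg_abs u x -> cvg_abs u y -> x = y.
Proof.
move=> /cvg_absP ux /cvg_absP uy; apply/eqP; rewrite -subr_eq0; apply/eqP.
apply: absv_small_eq => r r0.
have [N HN] := ux r r0; have [M HM] := uy r r0.
apply: (absv_dist_le (y := u (maxn N M))).
- by rewrite absv_subC HN ?leq_maxl.
- by rewrite HM ?leq_maxr.
Qed.

Lemma cvg_abs_lin (a : K) (u v : nat -> K) x y :
  cvg_abs u x -> cvg_abs v y -> cvg_abs (fun n => a * u n + v n) (a * x + y).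
Proof.
move=> /cvg_absP ux /cvg_absP vy; apply/cvg_absP => r r0.
have a0 : 0 < absv a + 1 by rewrite ltr_wpDl ?absv_ge0.
have [N HN] := ux (r / (absv a + 1)) (divr_gt0 r0 a0).
have [M HM] := vy r r0.
exists (maxn N M) => n; rewrite geq_max => /andP[Nn Mn].
rewrite opprD addrACA -mulrBr; apply: absv_add_le; last exact: HM.
rewrite absvM; apply: (@le_trans _ _ ((absv a + 1) * (r / (absv a + 1)))).
  by apply: ler_pM; rewrite ?absv_ge0 ?HN // lerDl.
by rewrite mulrC divfK // gt_eqF.
Qed.

Definition nullseq c := cvg_abs c 0.

Lemma nullseqP c :
  nullseq c <->
  (forall r, 0 < r -> exists N, forall n, (N <= n)%N -> absv (c n) <= r).
Proof.
split=> [/cvg_absP H r r0|H].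
- by have [N HN] := H r r0; exists N => n /HN; rewrite subr0.
- apply/cvg_absP => r r0; have [N HN] := H r r0.
  by exists N => n /HN; rewrite subr0.
Qed.

Lemma nullseq_lin (a : K) c d :
  nullseq c -> nullseq d -> nullseq (fun n => a * c n + d n).
Proof.
by move=> c0 d0; have := cvg_abs_lin a c0 d0; rewrite mulr0 addr0.
Qed.

Lemma nullseq_dominated c (d : nat -> R) :
  (forall r, 0 < r -> exists N, forall n, (N <= n)%N -> d n <= r) ->
  (forall n, absv (c n) <= d n) -> nullseq c.
Proof.
move=> d0 cd; apply/nullseqP => r r0; have [N HN] := d0 r r0.
by exists N => n /HN; apply: le_trans.
Qed.

Lemma nullseq_bounded c : nullseq c ->
  exists2 B : R, 0 <= B & forall n, absv (c n) <= B.
Proof.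
move=> /nullseqP /(_ 1 ltr01)[N HN].
exists (1 + \sum_(i < N) absv (c i)).
  by rewrite addr_ge0 // sumr_ge0 // => i _; rewrite absv_ge0.
move=> n; case: (leqP N n) => [/HN h|nN].
  by rewrite (le_trans h) // lerDl sumr_ge0 // => i _; rewrite absv_ge0.
rewrite (bigD1 (Ordinal nN)) //= addrCA lerDl addr_ge0 //.
by rewrite sumr_ge0 // => i _; rewrite absv_ge0.
Qed.

Lemma nullseqMl c (d : nat -> K) (B : R) :
  nullseq c -> (forall n, absv (d n) <= B) -> nullseq (fun n => c n * d n).
Proof.
move=> /nullseqP c0 dB.
have B0 : 0 <= B by apply: le_trans (dB 0%N); rewrite absv_ge0.
have B1 : 0 < B + 1 by rewrite ltr_wpDl.
apply/nullseqP => r r0; have [N HN] := c0 (r / (B + 1)) (divr_gt0 r0 B1).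
exists N => n /HN h; rewrite absvM.
apply: (@le_trans _ _ (r / (B + 1) * (B + 1))).
  by apply: ler_pM; rewrite ?absv_ge0 // (le_trans (dB n)) // lerDl.
by rewrite divfK // gt_eqF.
Qed.

Lemma nullseq_finite c N : (forall n, (N <= n)%N -> c n = 0) -> nullseq c.
Proof.
by move=> cN; apply/nullseqP => r r0; exists N => n /cN ->; rewrite absv0 ltW.
Qed.

Lemma nullseq_drop c N : nullseq c -> nullseq (fun n => c (N + n)%N).
Proof.
move=> /nullseqP c0; apply/nullseqP => r r0; have [M HM] := c0 r r0.
by exists M => n Mn; rewrite HM // (leq_trans Mn) // leq_addl.
Qed.

(** The default 0 on divergent series allows sums to be written without a convergence proof;
    [cvg_tsum] supplies convergence when the terms tend to 0. *)
Definition tsum c : K := xget 0 [set x | cvg_abs (series c) x].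

Lemma tsum_eq c x : cvg_abs (series c) x -> tsum c = x.
Proof.
by move=> cx; apply: (@cvg_abs_unique (series c)) => //; apply: xgetPex; exists x.
Qed.

Hypothesis Kc : complete_abs K.

(** By the ultrametric inequality a block of terms of size at most e/2 has a sum of size at most
    e/2, so null terms already give a Cauchy series. The half turns the weak bound into the strict
    one of [complete_abs]. *)
Lemma cvg_tsum c : nullseq c -> cvg_abs (series c) (tsum c).
Proof.
move=> /nullseqP c0; apply: xgetPex; apply: Kc => e e0.
have e20 : 0 < e / 2 by rewrite divr_gt0.
have [N HN] := c0 (e / 2) e20; exists N.
have H m n : (N <= m)%N -> (m <= n)%N -> absv (series c n - series c m) <= e / 2.
  move=> Nm mn; rewrite sub_series_geq //.
  rewrite big_nat_cond; apply: absv_sum_le; first exact: ltW.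
  by move=> i; rewrite andbT => /andP[mi _]; rewrite HN // (leq_trans Nm).
move=> m n Nm Nn; apply: (@le_lt_trans _ _ (e / 2)).
  case: (leqP m n) => [mn|/ltnW nm]; last exact: H.
  by rewrite absv_subC H.
by rewrite gtr_pMr // invf_lt1 // ltr1n.
Qed.

Lemma tsum_lin (a : K) c d : nullseq c -> nullseq d ->
  tsum (fun n => a * c n + d n) = a * tsum c + tsum d.
Proof.
move=> c0 d0; apply: tsum_eq.
rewrite (_ : series _ = fun n => a * series c n + series d n).
  by apply: cvg_abs_lin; apply: cvg_tsum.
apply/funext => n; rewrite /series /=.
by rewrite big_split /= -mulr_sumr.
Qed.

Lemma tsum_finite c N : (forall n, (N <= n)%N -> c n = 0) ->
  tsum c = \sum_(i < N) c i.
Proof.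
move=> cN; apply: tsum_eq; apply/cvg_absP => r r0; exists N => n Nn.
rewrite /series /= -(big_mkord xpredT c) (big_cat_nat (leq0n N) Nn) //=.
rewrite [X in _ + X - _]big_nat_cond [X in _ + X - _]big1 ?addr0 ?subrr ?absv0 ?ltW //.
by move=> i; rewrite andbT => /andP[/cN].
Qed.

Lemma tsum0 : tsum (fun=> 0) = 0.
Proof. by rewrite (@tsum_finite _ 0) // big_ord0. Qed.

Lemma nullseq0 : nullseq (fun=> 0).
Proof. by apply: (@nullseq_finite _ 0). Qed.

Lemma tsumZ (a : K) c : nullseq c -> tsum (fun n => a * c n) = a * tsum c.
Proof.
move=> c0; have := tsum_lin a c0 nullseq0.
by rewrite tsum0 addr0; under eq_fun do rewrite addr0.
Qed.

Lemma tsum_drop c N : nullseq c ->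
  tsum c = \sum_(i < N) c i + tsum (fun n => c (N + n)%N).
Proof.
move=> c0; apply: tsum_eq; apply/cvg_absP => r r0.
have /cvg_absP /(_ r r0)[M HM] := cvg_tsum (nullseq_drop N c0).
exists (N + M)%N => n NMn.
have Nn : (N <= n)%N by rewrite (leq_trans _ NMn) // leq_addr.
have /HM : (M <= n - N)%N by rewrite leq_subRL.
have -> : series c n = \sum_(i < N) c i + series (fun n => c (N + n)%N) (n - N)%N.
  rewrite /series /= (big_cat_nat (leq0n N) Nn) //= -(big_mkord xpredT c).
  rewrite -{2}[N]add0n big_addn; congr (_ + _).
  by apply: eq_bigr => i _; rewrite addnC.
by rewrite opprD addrACA subrr add0r.
Qed.

Lemma tsum_tail_le c N r : 0 <= r -> nullseq c ->
  (forall n, (N <= n)%N -> absv (c n) <= r) ->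
  absv (tsum c - \sum_(i < N) c i) <= r.
Proof.
move=> r0 c0 cr; rewrite (tsum_drop N c0) addrAC subrr add0r.
apply/ler_addgt0Pl => e e0.
have /cvg_absP /(_ e e0)[M HM] := cvg_tsum (nullseq_drop N c0).
have := HM M (leqnn M); set s := series _ _; set t := tsum _ => h.
have sr : absv s <= r.
  by apply: absv_sum_le => // i _; rewrite cr // leq_addr.
rewrite -(subrK s t) absv_add_le ?(absv_subC t) ?(le_trans h) ?lerDl //.
by rewrite (le_trans sr) // lerDr ltW.
Qed.

Lemma tsum_le c r : 0 <= r -> nullseq c -> (forall n, absv (c n) <= r) ->
  absv (tsum c) <= r.
Proof.
move=> r0 c0 cr; have := @tsum_tail_le c 0 r r0 c0 (fun n _ => cr n).
by rewrite big_ord0 subr0.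
Qed.

(** The hypothesis makes the terms small outside a finite square. Both iterated sums are then within
    r of the sum over a large square, where the order does not matter. *)
Lemma tsum_exchange (a : nat -> nat -> K) :
  (forall r, 0 < r -> exists N, forall n i, (N <= n)%N || (N <= i)%N ->
     absv (a n i) <= r) ->
  tsum (fun n => tsum (a n)) = tsum (fun i => tsum (a^~ i)).
Proof.
move=> a0.
have H b : (forall r, 0 < r -> exists N, forall n i, (N <= n)%N || (N <= i)%N ->
     absv (b n i) <= r) ->
    forall r, 0 < r -> exists M, forall N, (M <= N)%N ->
    absv (tsum (fun n => tsum (b n)) - \sum_(n < N) \sum_(i < N) b n i) <= r.
  move=> b0 r r0; have [M HM] := b0 r r0; exists M => N MN.
  have bn n : nullseq (b n).
    apply/nullseqP => s s0; have [L HL] := b0 s s0.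
    by exists L => i Li; rewrite HL ?Li ?orbT.
  have r0' := ltW r0.
  have tb : nullseq (fun n => tsum (b n)).
    apply/nullseqP => s s0; have [L HL] := b0 s s0.
    by exists L => n Ln; apply: tsum_le => [||i]; rewrite ?(ltW s0) ?HL ?Ln.
  apply: (absv_dist_le (y := \sum_(n < N) tsum (b n))).
    apply: tsum_tail_le => // n Nn; apply: tsum_le => // i.
    by rewrite HM // (leq_trans MN).
  rewrite -sumrB; apply: absv_sum_le => // n _; apply: tsum_tail_le => // i Ni.
  by rewrite HM // orbC (leq_trans MN).
apply/eqP; rewrite -subr_eq0; apply/eqP; apply: absv_small_eq => r r0.
have [M HM] := H a a0 r r0.
have [|M' HM'] := H (fun i n => a n i) _ r r0.
  move=> s /a0[N HN]; exists N => n i; rewrite orbC; exact: HN.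
pose N := maxn M M'.
apply: (absv_dist_le (y := \sum_(n < N) \sum_(i < N) a n i)).
  by rewrite HM ?leq_maxl.
by rewrite exchange_big /= absv_subC HM' ?leq_maxr.
Qed.

End NullSequences.

(** * Power series on the closed unit disc *)

Section PowerSeries.
Variables (R : realType) (K : ultrametricFieldType R).
Hypothesis Kc : complete_abs K.
Implicit Types (c d g : nat -> K) (u : K).

Definition power_sum c u : K := tsum (fun n => c n * u ^+ n).

Lemma absvX_le1 u n : absv u <= 1 -> absv (u ^+ n) <= 1.
Proof. by move=> u1; rewrite absvX exprn_ile1 ?absv_ge0. Qed.

Lemma nullseq_terms c u : nullseq c -> absv u <= 1 ->
  nullseq (fun n => c n * u ^+ n).
Proof. by move=> c0 u1; apply: (nullseqMl c0) => n; apply: absvX_le1. Qed.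

Lemma power_sum_lin (a : K) c d u : absv u <= 1 -> nullseq c -> nullseq d ->
  power_sum (fun n => a * c n + d n) u = a * power_sum c u + power_sum d u.
Proof.
move=> u1 c0 d0; rewrite /power_sum -tsum_lin //; try exact: nullseq_terms.
by congr tsum; apply/funext => n; rewrite mulrDl mulrA.
Qed.

Lemma power_sum_finite c u N : (forall n, (N <= n)%N -> c n = 0) ->
  power_sum c u = \sum_(i < N) c i * u ^+ i.
Proof. by move=> cN; apply: tsum_finite => n /cN ->; rewrite mul0r. Qed.

Lemma power_sum_le c u B : absv u <= 1 -> nullseq c ->
  (forall n, absv (c n) <= B) -> absv (power_sum c u) <= B.
Proof.
move=> u1 c0 cB.
have B0 : 0 <= B by apply: le_trans (cB 0%N); rewrite absv_ge0.
apply: tsum_le => //; first exact: nullseq_terms.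
by move=> n; rewrite absvM -[leRHS]mulr1 ler_pM ?absv_ge0 ?absvX_le1.
Qed.

(** The coefficients are d_i = \sum_n c_n g_(n,i). Products, powers and composites of power series
    are all obtained from this rearrangement, and the last clause carries coefficient bounds through
    them. *)
Lemma power_sum_double c (g : nat -> nat -> K) : nullseq c ->
  (forall n, nullseq (g n)) -> (forall n i, absv (g n i) <= 1) ->
  exists d, [/\ nullseq d,
    forall u, absv u <= 1 -> power_sum d u = tsum (fun n => c n * power_sum (g n) u) &
    forall B, (forall n, absv (c n) <= B) -> forall i, absv (d i) <= B].
Proof.
move=> c0 g0 g1; exists (fun i => tsum (fun n => c n * g n i)).
have cg0 i : nullseq (fun n => c n * g n i) by apply: (nullseqMl c0).
have cg_le n i : absv (c n * g n i) <= absv (c n).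
  by rewrite absvM -[leRHS]mulr1 ler_pM ?absv_ge0.
(* Rows n >= N1 are small because c is null; each of the finitely many other rows is small from some
   column on because g n is null. The quotient is by B + 1 since B may be 0. *)
have key r : 0 < r -> exists N, forall n i, (N <= n)%N || (N <= i)%N ->
    absv (c n * g n i) <= r.
  move=> r0; have /nullseqP /(_ r r0)[N1 HN1] := c0.
  have [B B0 cB] := nullseq_bounded c0.
  have B1 : 0 < B + 1 by rewrite ltr_wpDl.
  have [N2 HN2] : exists N2, forall n i, (n < N1)%N -> (N2 <= i)%N ->
      absv (g n i) <= r / (B + 1).
    elim: (N1) => [|M [N2 IH]]; first by exists 0%N.
    have /nullseqP /(_ _ (divr_gt0 r0 B1))[L HL] := g0 M.
    exists (maxn N2 L) => n i; rewrite ltnS geq_max => nM /andP[N2i Li].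
    by case: ltngtP nM => // [nM _|-> _]; [apply: IH|apply: HL].
  exists (maxn N1 N2) => n i; rewrite !geq_max.
  case: (leqP N1 n) => [N1n _|nN1 /=]; first by rewrite (le_trans (cg_le n i)) ?HN1.
  case/andP => _ N2i; rewrite absvM.
  apply: (@le_trans _ _ ((B + 1) * (r / (B + 1)))).
    by rewrite ler_pM ?absv_ge0 ?HN2 // (le_trans (cB n)) // lerDl.
  by rewrite mulrC divfK // gt_eqF.
split.
- apply/nullseqP => r r0; have [N HN] := key r r0.
  exists N => i Ni; apply: tsum_le => //; first exact: ltW.
  by move=> n; rewrite HN // Ni orbT.
- move=> u u1; rewrite /power_sum.
  transitivity (tsum (fun i => tsum (fun n => c n * g n i * u ^+ i))).
    congr tsum; apply/funext => i; rewrite mulrC -tsumZ //.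
    by congr tsum; apply/funext => n; rewrite mulrC.
  rewrite tsum_exchange //.
    congr tsum; apply/funext => n; rewrite -tsumZ //; last exact: nullseq_terms.
    by congr tsum; apply/funext => i; rewrite mulrA.
  move=> r /key[N HN]; exists N => i n Nin; apply: le_trans (HN n i _).
    by rewrite absvM -[leRHS]mulr1 ler_pM ?absv_ge0 ?absvX_le1.
  by rewrite orbC.
- move=> B cB i; have B0 : 0 <= B by apply: le_trans (cB 0%N); rewrite absv_ge0.
  by apply: tsum_le => // n; rewrite (le_trans (cg_le n i)).
Qed.

Lemma power_sum_shift m g : nullseq g ->
  exists h, [/\ nullseq h,
    forall u, absv u <= 1 -> power_sum h u = u ^+ m * power_sum g u &
    forall B, 0 <= B -> (forall n, absv (g n) <= B) -> forall n, absv (h n) <= B].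
Proof.
move=> g0; pose h n := if (m <= n)%N then g (n - m)%N else 0.
have h0 : nullseq h.
  have /nullseqP g0' := g0.
  apply/nullseqP => r r0; have [N HN] := g0' r r0.
  exists (m + N)%N => n mNn; rewrite /h (leq_trans (leq_addr N m) mNn) HN //.
  by rewrite leq_subRL // (leq_trans (leq_addr N m) mNn).
exists h; split => //.
- move=> u u1; rewrite /power_sum (tsum_drop Kc m); last exact: nullseq_terms.
  rewrite big1 ?add0r => [|i _]; last by rewrite /h leqNgt ltn_ord mul0r.
  rewrite -tsumZ //; last exact: nullseq_terms.
  congr tsum; apply/funext => n; rewrite /h leq_addr addKn exprD.
  by rewrite mulrCA.
- by move=> B B0 gB n; rewrite /h; case: ifP => _; rewrite ?absv0.
Qed.

(** The product is the double sum whose n-th inner series is u^n g'(u). *)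
Lemma power_sum_mul g g' : nullseq g -> nullseq g' ->
  (forall n, absv (g n) <= 1) -> (forall n, absv (g' n) <= 1) ->
  exists h, [/\ nullseq h, (forall n, absv (h n) <= 1) &
    forall u, absv u <= 1 -> power_sum h u = power_sum g u * power_sum g' u].
Proof.
move=> g0 g'0 g1 g'1.
have /choice[s Hs] := fun m => @power_sum_shift m g' g'0.
have [||h [h0 hE h1]] := @power_sum_double g s g0.
- by move=> n; case: (Hs n).
- by move=> n i; case: (Hs n) => _ _; apply.
exists h; split => //; first exact: h1.
move=> u u1; rewrite hE // mulrC -tsumZ //; last exact: nullseq_terms.
congr tsum; apply/funext => n; case: (Hs n) => _ -> // _.
by rewrite mulrA mulrC.
Qed.

Lemma power_sum_exp g m : nullseq g -> (forall n, absv (g n) <= 1) ->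
  exists h, [/\ nullseq h, (forall n, absv (h n) <= 1) &
    forall u, absv u <= 1 -> power_sum h u = power_sum g u ^+ m].
Proof.
move=> g0 g1; elim: m => [|m [h [h0 h1 hE]]].
  exists (fun n => (n == 0)%:R); split.
  - by apply: (@nullseq_finite _ _ _ 1) => -[].
  - by move=> [|n] /=; rewrite ?absv1 ?absv0.
  - by move=> u u1; rewrite (@power_sum_finite _ _ 1) => [|[]//];
    rewrite big_ord1 !expr0 mulr1.
have [h' [h'0 h'1 h'E]] := power_sum_mul g0 h0 g1 h1.
by exists h'; split => // u u1; rewrite h'E // hE // exprS.
Qed.

(** This is the double sum whose n-th inner series is the n-th power of g. *)
Lemma power_sum_comp c g : nullseq c -> nullseq g -> (forall n, absv (g n) <= 1) ->
  exists d, [/\ nullseq d,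
    forall u, absv u <= 1 -> power_sum d u = power_sum c (power_sum g u) &
    forall B, (forall n, absv (c n) <= B) -> forall i, absv (d i) <= B].
Proof.
move=> c0 g0 g1; have /choice[p Hp] := fun m => @power_sum_exp g m g0 g1.
have [||d [d0 dE dB]] := @power_sum_double c p c0.
- by move=> n; case: (Hp n).
- by move=> n i; case: (Hp n).
exists d; split => // u u1; rewrite dE //.
by congr tsum; apply/funext => n; case: (Hp n) => _ _ ->.
Qed.

Lemma power_sumS c u : nullseq c -> absv u <= 1 ->
  power_sum c u = c 0 + u * power_sum (fun n => c n.+1) u.
Proof.
move=> c0 u1; rewrite /power_sum (tsum_drop Kc 1) ?big_ord1; last exact: nullseq_terms.
rewrite expr0 mulr1 -tsumZ //; last first.
  exact/nullseq_terms/u1/(nullseq_drop 1 c0).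
by congr (_ + tsum _); apply/funext => n; rewrite add1n exprS mulrCA.
Qed.

(** The identity principle with zeros along a sequence only, since functions on S are evaluated at
    points of k and not of C. At the zero t_m the constant term is -t_m times a bounded quantity,
    hence 0; dividing by t_m passes to the shifted series. *)
Lemma power_sum_eq0 c (t : nat -> K) : nullseq c -> nullseq t ->
  (forall m, t m != 0) -> (forall m, absv (t m) <= 1) ->
  (forall m, power_sum c (t m) = 0) -> forall n, c n = 0.
Proof.
move=> + /nullseqP tnull t0 t1 + n.
have c00 d : nullseq d -> (forall m, power_sum d (t m) = 0) -> d 0%N = 0.
  move=> d0 dt; have d'0 : nullseq (fun n => d n.+1) by apply: (nullseq_drop 1 d0).
  have [B B0 dB] := nullseq_bounded d'0.
  have B1 : 0 < B + 1 by rewrite ltr_wpDl.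
  apply: absv_small_eq => r r0; have [N HN] := tnull _ (divr_gt0 r0 B1).
  have := dt N; rewrite power_sumS // => /eqP; rewrite addr_eq0 => /eqP ->.
  rewrite absvN absvM; apply: (@le_trans _ _ (r / (B + 1) * (B + 1))).
    by rewrite ler_pM ?absv_ge0 ?HN // (le_trans (power_sum_le (t1 N) d'0 dB)) // lerDl.
  by rewrite divfK // gt_eqF.
elim: n c => [|n IH] c c0 ct; first exact: c00.
apply: (IH (fun n => c n.+1)) => [|m]; first exact: (nullseq_drop 1 c0).
have := ct m; rewrite power_sumS // c00 // add0r => /eqP.
by rewrite mulf_eq0 (negPf (t0 m)) => /eqP.
Qed.

End PowerSeries.

(** * Expansions on balls of the projective line *)

Lemma expr_le_small (R : realType) (q r : R) : 0 <= q -> q < 1 -> 0 < r ->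
  exists N, forall n, (N <= n)%N -> q ^+ n <= r.
Proof.
move=> q0 q1 r0.
have /cvgrPdist_le /(_ r r0)[N _ HN] : (fun n => q ^+ n) @ \oo --> (0 : R).
  by apply: cvg_expr; rewrite ger0_norm.
exists N => n /HN; rewrite /= sub0r normrN ger0_norm ?exprn_ge0 //.
Qed.

(** Splitting off the constant term gives G(u) = v + w u G(u). This is the series that expands 1/x
    around a finite point. *)
Lemma power_sum_geometric (R : realType) (K : ultrametricFieldType R) (v w : K) :
  complete_abs K -> absv v <= 1 -> absv w < 1 ->
  [/\ nullseq (fun n => v * w ^+ n), (forall n, absv (v * w ^+ n) <= 1) &
    forall u : K, absv u <= 1 -> power_sum (fun n => v * w ^+ n) u = v / (1 - w * u)].
Proof.
move=> Kc v1 w1.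
have vw n : absv (v * w ^+ n) <= absv w ^+ n.
  by rewrite absvM absvX -[leRHS]mul1r ler_pM ?absv_ge0 ?exprn_ge0 ?absv_ge0.
have g0 : nullseq (fun n => v * w ^+ n).
  by apply: nullseq_dominated vw => r; apply: expr_le_small; rewrite ?absv_ge0.
split => // [n|u u1]; first by rewrite (le_trans (vw n)) // exprn_ile1 ?absv_ge0 // ltW.
have wu : 1 - w * u != 0.
  rewrite subr_eq0; apply/eqP => /(congr1 (@absv R K)); rewrite absv1 absvM => E.
  suff : absv w * absv u < 1 by rewrite -E ltxx.
  by rewrite -[ltRHS]mulr1 (le_lt_trans (ler_wpM2l (absv_ge0 w) u1)) // ltr_pM2r.
apply: (canRL (mulfK wu)); rewrite mulrBr mulr1.
rewrite {1}(power_sumS Kc g0 u1) expr0 mulr1.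
have -> : power_sum (fun n => v * w ^+ n.+1) u = w * power_sum (fun n => v * w ^+ n) u.
  rewrite -[RHS]addr0 -(@tsum0 R K).
  have -> : tsum (fun=> 0) = power_sum (fun=> 0) u.
    by congr tsum; apply/funext => n; rewrite mul0r.
  rewrite -power_sum_lin //; last exact: nullseq0.
  by congr (power_sum _ u); apply/funext => n; rewrite addr0 exprS; ring.
by ring.
Qed.

Section Balls.
Variables (R : realType) (k : ultrametricFieldType R).
Implicit Types (a b x : P1 k) (r s : R).

Lemma cball_center a r : 0 <= r -> cball a r a.
Proof. by case: a => //= a r0; rewrite subrr absv0. Qed.

(** For a = oo and b finite, |b| >= 1/r; moving by at most s < 1/r cannot bring the absolute value
    below 1/r. Hence the condition s r < 1 in that case only. *)
Lemma cball_recentre a b r s : 0 < s -> s <= r ->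
  (a = None -> b <> None -> s * r < 1) -> cball a r b -> cball b s `<=` cball a r.
Proof.
move=> s0 sr sr1 ab x bx.
case: a b x sr1 ab bx => [a|] [b|] [x|] //= sr1.
- by move=> ab bx; rewrite (absv_dist_le (y := b)) // (le_trans bx).
- have r0 := lt_le_trans s0 sr.
  move=> rb xb; rewrite leNgt; apply/negP => xr.
  have : absv b < r^-1.
    rewrite -[b](subrK x) addrC -opprB; apply: le_lt_trans (absvD_le _ _) _.
    rewrite gt_max xr absvN (le_lt_trans xb) //.
    by rewrite -[ltRHS]div1r ltr_pdivlMr // sr1.
  by rewrite ltNge rb.
- by move=> _; apply: le_trans; rewrite lef_pV2 // posrE ?(lt_le_trans s0 sr).
Qed.

Lemma local_coord_le a x r : 0 < r -> cball a r x -> absv (local_coord a x) <= r.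
Proof.
case: a x => [a|] [x|] //= r0; last by rewrite absv0 ltW.
move=> h; rewrite absvV -[leRHS]invrK lef_pV2 // posrE ?invr_gt0 //.
by apply: lt_le_trans h; rewrite invr_gt0.
Qed.

End Balls.

(** * Change of centre and uniqueness of expansions *)

Section Expansions.
Variables (R : realType) (k C : ultrametricFieldType R).
Variables (pi : k) (iota : {rmorphism k -> C}) (S : set (P1 k)).
Hypothesis iotaE : forall x, absv (iota x) = absv x.
Hypothesis Cc : complete_abs C.
Implicit Types (f h : S -> C) (a b : P1 k) (rho sigma : k) (c d : nat -> C).

Definition scaled_coord a rho x : C := iota (local_coord a x / rho).

Lemma scaled_coord_le1 a rho x :
  rho != 0 -> cball a (absv rho) x -> absv (scaled_coord a rho x) <= 1.
Proof.
rewrite -absv_gt0 => r0 ax; rewrite iotaE absvM absvV ler_pdivrMr // mul1r.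
exact: local_coord_le.
Qed.

Lemma expansionP f a rho c : rho != 0 ->
  expansion iota f a rho c <-> nullseq c /\
  (forall x : S, cball a (absv rho) (sval x) ->
     f x = power_sum c (scaled_coord a rho (sval x))).
Proof.
move=> r0; split=> -[c0 H]; split=> // x ax.
- by rewrite -(tsum_eq (H x ax)).
- by rewrite (H x ax); apply: cvg_tsum => //; apply/nullseq_terms/scaled_coord_le1.
Qed.

(** The old coordinate is affine in the new one when both centres are finite or both are oo, and a
    geometric series when the centre moves from oo to a finite point; s r < 1 makes the ratio of
    that series smaller than 1. *)
Lemma scaled_coord_recentre a b rho sigma : rho != 0 -> sigma != 0 ->
  absv sigma <= absv rho ->
  (a = None -> b <> None -> absv sigma * absv rho < 1) ->
  cball a (absv rho) b ->
  exists g, [/\ nullseq g, (forall n, absv (g n) <= 1) &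
    forall x, cball b (absv sigma) x ->
      scaled_coord a rho x = power_sum g (scaled_coord b sigma x)].
Proof.
move=> r0 s0 sr sr1 ab.
have sr_le1 : absv (iota (sigma / rho)) <= 1.
  by rewrite iotaE absvM absvV ler_pdivrMr ?mul1r // absv_gt0.
have affine v : absv v <= 1 -> exists g, [/\ nullseq g, (forall n, absv (g n) <= 1) &
    forall u, absv u <= 1 -> power_sum g u = v + iota (sigma / rho) * u].
  move=> v1; exists (fun n =>
    if n is m.+1 then if m is 0 then iota (sigma / rho) else 0 else v).
  split.
  - by apply: (@nullseq_finite _ _ _ 2) => -[|[]].
  - by move=> [|[|n]] //; rewrite absv0.
  - move=> u u1; rewrite (@power_sum_finite _ _ _ _ 2) => [|[|[]]] //.
    by rewrite !big_ord_recr big_ord0 /= add0r expr0 mulr1 expr1.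
case: a b ab sr1 => [a|] [b|] //= ab sr1.
- have [|g [g0 g1 gE]] := affine (iota ((b - a) / rho)).
    by rewrite iotaE absvM absvV ler_pdivrMr ?mul1r // absv_gt0.
  exists g; split => // x bx.
  have bu := @scaled_coord_le1 (Some b) _ _ s0 bx; rewrite (gE _ bu).
  rewrite /scaled_coord -rmorphM -rmorphD.
  case: x bx {bu} => // x bx; congr (iota _); rewrite /=; field.
  by rewrite r0 s0.
- have b0 : b != 0.
    by rewrite -absv_gt0; apply: lt_le_trans ab; rewrite invr_gt0 absv_gt0.
  have v1 : absv (iota (rho * b)^-1) <= 1.
    have ra0 : 0 < absv rho by rewrite absv_gt0.
    rewrite iotaE absvV absvM -[leRHS]invr1 lef_pV2 ?posrE ?mulr_gt0 ?absv_gt0 //.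
    by rewrite mulrC -ler_pdivrMr // mul1r.
  have w1 : absv (iota (- sigma / b)) < 1.
    rewrite iotaE absvM absvV absvN ltr_pdivrMr ?absv_gt0 // mul1r.
    apply: lt_le_trans ab; rewrite -[ltRHS]div1r ltr_pdivlMr ?absv_gt0 //.
    exact: sr1.
  have [g0 g1 gE] := power_sum_geometric Cc v1 w1.
  (* 1 / (rho x) = (1 / (rho b)) / (1 + (sigma / b) u) for x = b + sigma u *)
  exists (fun n => iota (rho * b)^-1 * iota (- sigma / b) ^+ n); split => //.
  move=> x bx; have bu := @scaled_coord_le1 (Some b) _ _ s0 bx; rewrite (gE _ bu).
  have : 1 - iota (- sigma / b) * scaled_coord (Some b) sigma x != 0.
    rewrite subr_eq0; apply/eqP => /(congr1 (@absv R C)); rewrite absv1 absvM => E.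
    suff : absv (iota (- sigma / b)) * absv (scaled_coord (Some b) sigma x) < 1.
      by rewrite -E ltxx.
    by rewrite -[ltRHS]mulr1 (le_lt_trans (ler_wpM2l (absv_ge0 _) bu)) // ltr_pM2r.
  rewrite /scaled_coord -rmorphM -(rmorph1 iota) -rmorphB fmorph_eq0.
  rewrite -fmorphV -rmorphM.
  case: x bx {bu} => // x bx /= h; congr (iota _).
  have E : 1 - - sigma / b * ((x - b) / sigma) = x / b.
    by field; rewrite s0 b0.
  move: h; rewrite E => h.
  have x0 : x != 0 by apply: contraNneq h => ->; rewrite mul0r.
  by field; rewrite r0 x0 b0.
- have [|g [g0 g1 gE]] := affine 0; first by rewrite absv0.
  exists g; split => // x bx.
  have bu := @scaled_coord_le1 None _ _ s0 bx; rewrite (gE _ bu) add0r /scaled_coord -rmorphM.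
  congr (iota _); field; by rewrite r0 s0.
Qed.

(** Substitute the coordinate change into the series. The bound on d is kept because it yields the
    comparison of norms between levels. *)
Lemma expansion_recentre f a b rho sigma c : rho != 0 -> sigma != 0 ->
  absv sigma <= absv rho ->
  (a = None -> b <> None -> absv sigma * absv rho < 1) ->
  cball a (absv rho) b -> expansion iota f a rho c ->
  exists2 d, expansion iota f b sigma d &
    forall B, (forall n, absv (c n) <= B) -> forall n, absv (d n) <= B.
Proof.
move=> r0 s0 sr sr1 ab /(expansionP _ _ _ r0)[c0 fE].
have [g [g0 g1 gE]] := scaled_coord_recentre r0 s0 sr sr1 ab.
have [d [d0 dE dB]] := power_sum_comp Cc c0 g0 g1.
exists d => //; apply/expansionP => //; split => // x bx.
rewrite dE ?scaled_coord_le1 // -gE // -fE //.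
by apply: cball_recentre bx => //; rewrite absv_gt0.
Qed.

Lemma expansion_lin (z : C) f h a rho c d : rho != 0 ->
  expansion iota f a rho c -> expansion iota h a rho d ->
  expansion iota (fun x => z * f x + h x) a rho (fun n => z * c n + d n).
Proof.
move=> r0 /(expansionP _ _ _ r0)[c0 fE] /(expansionP _ _ _ r0)[d0 hE].
apply/expansionP => //; split; first exact: nullseq_lin.
by move=> x ax; rewrite power_sum_lin ?scaled_coord_le1 // fE // hE.
Qed.

Hypothesis pi_neq0 : pi != 0.
Hypothesis pi_lt1 : absv pi < 1.

Lemma expansion_unique f a rho c d : rho != 0 -> cball a (absv rho) `<=` S ->
  expansion iota f a rho c -> expansion iota f a rho d -> c = d.
Proof.
move=> r0 aS fc fd; have := expansion_lin (-1) r0 fc fd.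
move=> /(expansionP _ _ _ r0)[e0 eE]; apply/funext => n; apply/eqP.
rewrite eq_sym -subr_eq0 addrC -mulN1r; apply/eqP; move: n.
apply: (power_sum_eq0 Cc (t := fun m => iota (pi ^+ m)) e0).
- apply: (@nullseq_dominated _ _ _ (fun m => absv pi ^+ m)).
    by move=> r; apply: expr_le_small; rewrite ?absv_ge0.
  by move=> n; rewrite iotaE absvX.
- by move=> m; rewrite fmorph_eq0 expf_neq0.
- by move=> m; rewrite iotaE absvX_le1 // ltW.
move=> m; have p0 : pi ^+ m != 0 by rewrite expf_neq0.
have pm1 : absv (rho * pi ^+ m) <= absv rho.
  by rewrite absvM -[leRHS]mulr1 ler_wpM2l ?absv_ge0 // absvX_le1 // ltW.
pose x : P1 k := if a is Some b then Some (b + rho * pi ^+ m)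
                 else Some (rho * pi ^+ m)^-1.
have xa : cball a (absv rho) x.
  rewrite /x; case: (a) => [b|] /=; first by rewrite addrAC subrr add0r.
  by rewrite absvV lef_pV2 // posrE absv_gt0 // mulf_neq0.
have := eE (exist _ x (mem_set (aS _ xa))) xa.
rewrite /= mulN1r addNr => ->; congr power_sum.
rewrite /scaled_coord; congr (iota _); rewrite /x; case: (a) => [b|] /=.
  by rewrite addrAC subrr add0r mulrAC divff // mul1r.
by rewrite invrK mulrAC divff // mul1r.
Qed.

End Expansions.

(** * Locally analytic functions at a fixed level *)

HB.instance Definition _ (R : realType) (k : ultrametricFieldType R) :=
  isPointed.Build (P1 k) None.

Section Compactness.
Variables (R : realType) (k : ultrametricFieldType R) (S : set (P1 k)).
Hypothesis S_compact : compact S.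

Lemma open_cball (a : P1 k) r : 0 < r -> open (cball a r).
Proof.
move=> r0; suff : P1_open (cball a r) by [].
move=> b ab.
have r1 : 0 < r + 1 by rewrite ltr_wpDl ?ltW.
(* The second term forces the product of the new radius with r below 1, as recentring from oo
   requires. *)
exists (Num.min r (r + 1)^-1); first by rewrite lt_min r0 invr_gt0.
apply: cball_recentre => //; first by rewrite lt_min r0 invr_gt0.
  by rewrite ge_min lexx.
move=> _ _; apply: (@le_lt_trans _ _ ((r + 1)^-1 * r)).
  by rewrite ler_pM2r // ge_min lexx orbT.
by rewrite mulrC ltr_pdivrMr // mul1r ltrDl.
Qed.

Lemma compact_finite_balls (I : set (P1 k)) (r : P1 k -> R) :
  (forall a, I a -> 0 < r a) -> S `<=` \bigcup_(a in I) cball a (r a) ->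
  exists2 s : seq (P1 k), (forall a, a \in s -> I a) &
    S `<=` \bigcup_(a in [set` s]) cball a (r a).
Proof.
move=> r0 SI; move: S_compact; rewrite compact_cover => /(_ _ I (fun a => cball a (r a))).
case=> [a /r0|//|D DI SD]; first exact: open_cball.
by exists (finmap.enum_fset D) => // a /DI /set_mem.
Qed.

(** A Lebesgue number argument: the powers of q eventually drop below the finitely many radii of a
    subcover. The last inequality is the side condition for recentring from oo. *)
Lemma uniform_radius (q : R) (r : P1 k -> R) : 0 < q -> q < 1 ->
  (forall a, S a -> 0 < r a) ->
  exists L, forall l, (L <= l)%N -> forall b, S b -> exists a,
    [/\ S a, cball a (r a) b, q ^+ l <= r a & q ^+ l * r a < 1].
Proof.
move=> q0 q1 r0.
have [a Sa|s sS Ss] := @compact_finite_balls S r r0.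
  by exists a => //; apply: cball_center; rewrite ltW ?r0.
have [L HL] : exists L, forall l, (L <= l)%N -> forall a, a \in s ->
    q ^+ l <= r a /\ q ^+ l * r a < 1.
  elim: s sS {Ss} => [|a s IH] sS; first by exists 0%N.
  have [|L HL] := IH; first by move=> b bs; apply: sS; rewrite inE bs orbT.
  have ra0 : 0 < r a by apply/r0/sS; rewrite inE eqxx.
  have ra1 : 0 < r a + 1 by rewrite ltr_wpDl ?ltW.
  have m0 : 0 < Num.min (r a) (r a + 1)^-1 by rewrite lt_min ra0 invr_gt0.
  have [N HN] := expr_le_small (ltW q0) q1 m0.
  exists (maxn L N) => l; rewrite geq_max => /andP[Ll Nl] b.
  rewrite inE => /predU1P[->|/HL]; last exact.
  have := HN l Nl; rewrite le_min => /andP[-> h]; split => //.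
  apply: (@le_lt_trans _ _ ((r a + 1)^-1 * r a)); first by rewrite ler_pM2r.
  by rewrite mulrC ltr_pdivrMr // mul1r ltrDl.
exists L => l Ll b /Ss[a /= sa ab]; exists a.
by have [] := HL l Ll a sa; split => //; apply: sS.
Qed.

End Compactness.

(** * Taylor coefficients, norms and decompositions at one level *)

Section Levels.
Variables (R : realType) (k C : ultrametricFieldType R).
Variables (pi : k) (iota : {rmorphism k -> C}) (S : set (P1 k)).
Hypothesis iotaE : forall x, absv (iota x) = absv x.
Hypothesis Cc : complete_abs C.
Hypothesis pi_neq0 : pi != 0.
Hypothesis pi_lt1 : absv pi < 1.
Implicit Types (f h : S -> C) (a b : P1 k) (c d : nat -> C) (l : nat).

Local Notation q := (absv pi).

Lemma absv_pi_gt0 : 0 < q. Proof. by rewrite absv_gt0. Qed.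
Local Hint Resolve absv_pi_gt0 : core.

Lemma absv_piX_gt0 l : 0 < q ^+ l. Proof. exact: exprn_gt0. Qed.
Local Hint Resolve absv_piX_gt0 : core.

Lemma absv_piX_lt1 l : (0 < l)%N -> q ^+ l < 1.
Proof. by move=> l0; rewrite exprn_ilt1 ?ltW // -lt0n. Qed.

Lemma absv_piX_le l l' : (l <= l')%N -> q ^+ l' <= q ^+ l.
Proof. by move=> ll; rewrite ler_wiXn2l ?ltW. Qed.

Lemma absv_piXM_lt1 l l' : (0 < l)%N -> q ^+ l * q ^+ l' < 1.
Proof.
move=> l0; rewrite -exprD; apply: absv_piX_lt1.
by rewrite (leq_trans l0) // leq_addr.
Qed.

Lemma piX_neq0 l : pi ^+ l != 0. Proof. by rewrite expf_neq0. Qed.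
Local Hint Resolve piX_neq0 : core.

Lemma ballpiE a l : ballpi pi a l = cball a (absv (pi ^+ l)).
Proof. by rewrite absvX. Qed.

Lemma ballpi_center a l : ballpi pi a l a.
Proof. by apply: cball_center; rewrite ltW. Qed.

Lemma ballpi_recentre a b l l' : (0 < l)%N -> (l <= l')%N ->
  ballpi pi a l b -> ballpi pi b l' `<=` ballpi pi a l.
Proof.
move=> l0 ll; apply: cball_recentre => //; first exact: absv_piX_le.
by move=> _ _; rewrite mulrC absv_piXM_lt1.
Qed.

(** The precise sense in which a level is sufficiently large. Positivity of l makes |pi|^l |pi|^l' <
    1, so that recentring from oo is allowed between any two levels. *)
Definition admissible l :=
  (0 < l)%N /\ forall a, S a -> ballpi pi a l `<=` S.

Lemma admissible_gt0 l : admissible l -> (0 < l)%N. Proof. by case. Qed.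

Lemma ballpi_sub a l : admissible l -> S a -> cball a (absv (pi ^+ l)) `<=` S.
Proof. by case=> _ H /H; rewrite ballpiE. Qed.

Lemma expansion_recentre_pi f a b l l' c : (0 < l)%N -> (l <= l')%N ->
  ballpi pi a l b -> expansion iota f a (pi ^+ l) c ->
  exists2 d, expansion iota f b (pi ^+ l') d &
    forall B, (forall n, absv (c n) <= B) -> forall n, absv (d n) <= B.
Proof.
move=> l0 ll; rewrite ballpiE => ab; apply: expansion_recentre => //.
  by rewrite !absvX absv_piX_le.
by move=> _ _; rewrite !absvX mulrC absv_piXM_lt1.
Qed.

(** The radius allowed by [LAl] may exceed |pi|^l and vary with the point; recentring at the same
    point shrinks it to exactly |pi|^l. *)
Lemma LAlP l f : admissible l ->
  LAl pi iota l f <-> forall a, S a -> exists c, expansion iota f a (pi ^+ l) c.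
Proof.
move=> adm; split=> H a Sa.
- have [rho lrho [_ [c fc]]] := H a Sa.
  have rho0 : rho != 0 by rewrite -absv_gt0 (lt_le_trans _ lrho).
  have aa : cball a (absv rho) a by apply: cball_center; apply: absv_ge0.
  have lr : absv (pi ^+ l) <= absv rho by rewrite absvX.
  have aN : a = None -> a <> None -> absv (pi ^+ l) * absv rho < 1 by [].
  have [d fd _] := expansion_recentre iotaE Cc rho0 (piX_neq0 l) lr aN aa fc.
  by exists d.
- have [c fc] := H a Sa; exists (pi ^+ l); first by rewrite absvX.
  by split; [exact: ballpi_sub|exists c].
Qed.

Lemma LAl_lin l (z : C) f h : admissible l ->
  LAl pi iota l f -> LAl pi iota l h -> LAl pi iota l (fun x => z * f x + h x).
Proof.
move=> adm /(LAlP _ adm) fl /(LAlP _ adm) hl; apply/LAlP => // a Sa.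
have [c fc] := fl a Sa; have [d hd] := hl a Sa.
by eexists; apply: expansion_lin fc hd.
Qed.

Lemma LAl_mono l l' : (l <= l')%N -> @LAl _ _ _ pi iota S l `<=` LAl pi iota l'.
Proof.
move=> ll f fl a /fl[rho lrho H]; exists rho => //.
by apply: le_trans lrho; apply: absv_piX_le.
Qed.

Lemma LAl_LA l : @LAl _ _ _ pi iota S l `<=` @LA _ _ _ iota S.
Proof.
move=> f fl a /fl[rho lrho H]; exists rho => //.
by rewrite -absv_gt0; apply: lt_le_trans lrho.
Qed.

Lemma expansion0 a l : expansion iota (fun _ : S => 0 : C) a (pi ^+ l) (fun=> 0).
Proof.
apply/expansionP => //; split; first exact: nullseq0.
by move=> x _; rewrite (@power_sum_finite _ _ _ _ 0) // big_ord0.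
Qed.

Lemma LAl0 l : admissible l -> LAl pi iota l (fun _ : S => 0 : C).
Proof. by move=> adm; apply/LAlP => // a _; eexists; apply: expansion0. Qed.

Definition taylor_coef l a f : nat -> C :=
  xget (fun=> 0) [set c | expansion iota f a (pi ^+ l) c].

Lemma taylor_coefE l a f c : admissible l -> S a -> expansion iota f a (pi ^+ l) c ->
  taylor_coef l a f = c.
Proof.
move=> adm Sa fc; apply: (@expansion_unique _ _ _ pi iota S _ _ _ _ f a (pi ^+ l)) => //.
  exact: ballpi_sub.
exact: (@xgetPex _ _ [set e | expansion iota f a (pi ^+ l) e] (ex_intro _ c fc)).
Qed.

Lemma expansion_taylor_coef l a f : admissible l -> S a -> LAl pi iota l f ->
  expansion iota f a (pi ^+ l) (taylor_coef l a f).
Proof.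
by move=> adm Sa /(LAlP _ adm)/(_ a Sa)[c fc]; rewrite (taylor_coefE adm Sa fc).
Qed.

Lemma nullseq_taylor_coef l a f : admissible l -> S a -> LAl pi iota l f ->
  nullseq (taylor_coef l a f).
Proof. by move=> adm Sa /(expansion_taylor_coef adm Sa)[]. Qed.

Lemma taylor_coef_lin l a (z : C) f h : admissible l -> S a ->
  LAl pi iota l f -> LAl pi iota l h ->
  taylor_coef l a (fun x => z * f x + h x) =
    fun n => z * taylor_coef l a f n + taylor_coef l a h n.
Proof.
move=> adm Sa fl hl; apply: taylor_coefE => //.
by apply: expansion_lin => //; apply: expansion_taylor_coef.
Qed.

Section Decomposition.
Variables (l : nat) (D : seq (P1 k)).
Hypothesis adm : admissible l.
Hypothesis HD : ball_decomposition pi S l D.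

Lemma decomposition_ball a : a \in D -> ballpi pi a l `<=` S.
Proof. by case: HD => -> _ aD x ax; exists a. Qed.

Lemma decomposition_mem a : a \in D -> S a.
Proof. by move/decomposition_ball; apply; apply: ballpi_center. Qed.
Local Hint Resolve decomposition_mem : core.

Lemma decomposition_cover b : S b -> exists2 a, a \in D & ballpi pi a l b.
Proof. by case: HD => {1}-> _ [a /= aD ab]; exists a. Qed.

Lemma decomposition_inj a b x : a \in D -> b \in D ->
  ballpi pi a l x -> ballpi pi b l x -> a = b.
Proof. by case: HD => _ tD aD bD ax bx; apply: tD => //; exists x. Qed.

(** A ball with finite centre never contains oo, so if oo is in S then oo is itself one of the
    centres, and disjointness keeps the finite centres out of its ball. *)
Lemma decomposition_centre a : a \in D -> is_centre pi S l a.
Proof.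
move=> aD; split; first exact: decomposition_ball.
move=> /decomposition_cover[[b|] bD //= _].
case: a aD => [a|] aD; [right|by left] => h.
by have := decomposition_inj aD bD (ballpi_center _ _) h.
Qed.

Lemma taylor_coef_le_norm f a n : LAl pi iota l f -> a \in D ->
  absv (taylor_coef l a f n) <= LAl_norm pi iota l D f.
Proof.
move=> fl aD; rewrite /LAl_norm.
apply: (@Order.TotalTheory.bigmax_sup_seq _ _ _ _ _ a xpredT) => //.
apply: ub_le_sup; last first.
  by exists (taylor_coef l a f), n; split => //; apply: expansion_taylor_coef => //; eauto.
have Sa := decomposition_mem aD.
have [B _ cB] := nullseq_bounded (nullseq_taylor_coef adm Sa fl).
by exists B => _ [c [m [/(taylor_coefE adm Sa) <- ->]]].
Qed.

Lemma LAl_norm_le f B : 0 <= B ->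
  (forall a, a \in D -> exists2 c, expansion iota f a (pi ^+ l) c &
     forall n, absv (c n) <= B) ->
  LAl_norm pi iota l D f <= B.
Proof.
move=> B0 H; rewrite /LAl_norm big_seq; apply: bigmax_le => // a aD.
have [c fc cB] := H a aD.
have Sa := decomposition_mem aD.
apply: ge_sup; first by exists (absv (c 0%N)), c, 0%N.
by move=> _ [d [m [/(taylor_coefE adm Sa) <- ->]]]; rewrite (taylor_coefE adm Sa fc).
Qed.

End Decomposition.

(** Balls of equal radius around finite points coincide once they meet, but a finite ball may be
    properly contained in the ball at oo. The proviso in [is_centre] excludes exactly the failing
    case, a finite and b = oo. *)
Lemma centre_ball_mem l a b x : (0 < l)%N -> is_centre pi S l a -> S b ->
  ballpi pi b l x -> ballpi pi a l x -> ballpi pi a l b.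
Proof.
move=> l0 [aS ca] Sb bx ax.
have ball_sym (c d : k) : ballpi pi (Some c) l (Some d) -> ballpi pi (Some d) l (Some c).
  by rewrite /ballpi /= absv_subC.
case: a b x aS ca Sb bx ax => [a|] [b|] [x|] // aS ca Sb bx ax.
- exact: (ballpi_recentre l0 (leqnn l) ax (ball_sym _ _ bx)).
- have [//|[]] := ca Sb.
  exact: (ballpi_recentre l0 (leqnn l) bx (ball_sym _ _ ax)).
- exact: (ballpi_recentre l0 (leqnn l) ax (ball_sym _ _ bx)).
Qed.

Lemma centre_meet l a b x : (0 < l)%N -> is_centre pi S l a -> is_centre pi S l b ->
  ballpi pi a l x -> ballpi pi b l x -> ballpi pi a l b /\ (a = None <-> b = None).
Proof.
move=> l0 ca cb ax bx.
have Sc (c : P1 k) : is_centre pi S l c -> S c by case=> cS _; apply: cS; apply: ballpi_center.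
have ab := centre_ball_mem l0 ca (Sc _ cb) bx ax.
have ba := centre_ball_mem l0 cb (Sc _ ca) ax bx.
by split=> //; split=> E; move: ab ba; rewrite E; case: (a) (b) => [?|] [?|].
Qed.

(** Compactness gives a finite cover by balls, with centre oo for the points near oo so that the
    proviso on centres holds. Going through the list, a ball that meets one already kept lies inside
    it and is dropped. *)
Lemma decomposition_exists l : compact S -> admissible l ->
  exists2 D, uniq D & ball_decomposition pi S l D.
Proof.
move=> S_compact adm; have l0 := admissible_gt0 adm.
have [//||s sc Ss] := @compact_finite_balls _ _ _ S_compact
    (is_centre pi S l) (fun=> q ^+ l).
  move=> b Sb; case: (pselect (S None /\ ballpi pi None l b)) => [[SN Nb]|H].
    by exists None => //; split; [case: adm => _; apply|left].
  exists b; last exact: ballpi_center.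
  by split; [case: adm => _; apply|move=> SN; right => Nb; apply: H].
suff [D [Du Ds tD HD]] : exists D, [/\ uniq D, {subset D <= s},
    trivIset [set` D] (fun a => ballpi pi a l) &
    forall b a, a \in s -> ballpi pi a l b -> exists2 d, d \in D & ballpi pi d l b].
  exists D => //; split => //; apply/seteqP; split => b.
    by move=> /Ss[a /= /HD H /H[d dD db]]; exists d.
  by case=> a /= /Ds /sc[aS _] /aS.
elim: s sc {Ss} => [|a s IH] sc.
  by exists [::]; split => // i j; rewrite /= in_nil.
have [|D [Du Ds tD HD]] := IH; first by move=> b bs; apply: sc; rewrite inE bs orbT.
have ca : is_centre pi S l a by apply: sc; rewrite inE eqxx.
case: (pselect (exists2 b, b \in D & ballpi pi a l `&` ballpi pi b l !=set0)) => [|disj].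
  case=> b bD [x [ax bx]]; exists D; split => //.
    by move=> d /Ds; rewrite inE => ->; rewrite orbT.
  move=> y d; rewrite inE => /predU1P[->|]; last exact: HD.
  move=> ay; exists b => //; apply: (ballpi_recentre l0 (leqnn l) _ ay).
  by have [] := centre_meet l0 (sc b _) ca bx ax; rewrite // inE Ds ?orbT.
exists (a :: D); split => /=.
- rewrite Du andbT; apply/negP => aD; apply: disj; exists a => //.
  by exists a; split; apply: ballpi_center.
- by move=> d; rewrite !inE => /predU1P[->|/Ds ->]; rewrite ?eqxx ?orbT.
- move=> i j /=; rewrite !inE => /predU1P[->|iD] /predU1P[->|jD] //; last exact: tD.
  + by move=> ne; case: disj; exists j.
  + by rewrite setIC => ne; case: disj; exists i.
- move=> b d; rewrite inE => /predU1P[->|ds] db.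
    by exists a => //; rewrite inE eqxx.
  by have [e eD eb] := HD b d ds db; exists e => //; rewrite inE eD orbT.
Qed.

(** Compactness replaces the radii of analyticity, which depend on the point, by one level; thus
    [LA] is the union of the [LAl]. *)
Lemma LA_LAl f : compact S -> @LA _ _ _ iota S f ->
  exists L, forall l, (L <= l)%N -> LAl pi iota l f.
Proof.
move=> S_compact fLA.
have /choice[rho Hrho] : forall a, exists rho : k,
    S a -> rho != 0 /\ analytic_on_ball iota f a rho.
  move=> a; case: (pselect (S a)) => [/fLA[rho r0 H]|nSa]; first by exists rho.
  by exists 0.
have [|L HL] := uniform_radius S_compact absv_pi_gt0 pi_lt1 (r := fun a => absv (rho a)).
  by move=> a /Hrho[]; rewrite absv_gt0.
exists L => l /HL Hl b /Hl[a [/Hrho[rho0 [aS [c fc]]] ab l1 l2]].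
exists (pi ^+ l); first by rewrite absvX.
have lr : absv (pi ^+ l) <= absv (rho a) by rewrite absvX.
have lr1 : a = None -> b <> None -> absv (pi ^+ l) * absv (rho a) < 1.
  by move=> _ _; rewrite absvX.
split; first by apply: subset_trans aS; apply: cball_recentre; rewrite // absvX.
by have [d fd _] := expansion_recentre iotaE Cc rho0 (piX_neq0 l) lr lr1 ab fc; exists d.
Qed.

Lemma admissible_near : compact S -> open S -> exists L, forall l, (L <= l)%N -> admissible l.
Proof.
move=> S_compact S_open; have {}S_open : P1_open S := S_open.
have /choice[r Hr] : forall a, exists r : R, S a -> 0 < r /\ cball a r `<=` S.
  move=> a; case: (pselect (S a)) => [/S_open[r r0 H]|nSa]; first by exists r.
  by exists 0.
have [|L HL] := uniform_radius S_compact absv_pi_gt0 pi_lt1 (r := r).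
  by move=> a /Hr[].
(* The successor guarantees l > 0. *)
exists L.+1 => l Ll; split; first exact: leq_ltn_trans Ll.
move=> b /(HL l (ltnW Ll))[a [/Hr[r0 aS] ab l1 l2]].
by apply: subset_trans aS; apply: cball_recentre.
Qed.

End Levels.

(** * Functionals given by weights *)

Section LinearSpan.
Variables (K : pzRingType) (X : Type).
Implicit Types (P Q G : set (X -> K)) (mu nu : (X -> K) -> K) (f g : X -> K).

Definition lincomb_closed P : Prop :=
  P (fun=> 0) /\ forall z f g, P f -> P g -> P (fun x => z * f x + g x).

Lemma lincomb_closed_sum P (I : eqType) (s : seq I) (F : I -> X -> K) :
  lincomb_closed P -> (forall i, i \in s -> P (F i)) ->
  P (fun x => \sum_(i <- s) F i x).
Proof.
move=> [P0 PD]; elim: s => [|i s IH] PF.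
  by under eq_fun do rewrite big_nil.
under eq_fun do rewrite big_cons -[F i _]mul1r.
apply: PD; first by apply: PF; rewrite inE eqxx.
by apply: IH => j js; apply: PF; rewrite inE js orbT.
Qed.

Lemma lincomb_closedZ P z f : lincomb_closed P -> P f -> P (fun x => z * f x).
Proof. by move=> [P0 PD] Pf; have := PD z _ _ Pf P0; under eq_fun do rewrite addr0. Qed.

Lemma linear_span_ind G P : P (fun=> 0) ->
  (forall z f g, G f -> P g -> P (fun x => z * f x + g x)) ->
  linear_span G `<=` P.
Proof.
move=> P0 PD f [n [c [g [Gg ->]]]].
elim: n c g Gg => [|n IH] c g Gg; first by under eq_fun do rewrite big_ord0.
under eq_fun do rewrite big_ord_recl.
by apply: PD => //; apply: IH.
Qed.

Lemma lincomb_closed_span G : lincomb_closed (linear_span G).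
Proof.
have span0 : linear_span G (fun=> 0).
  by exists 0, (fun=> 0), (fun=> fun=> 0); split; [case|apply/funext => x; rewrite big_ord0].
split=> // z f g + Hg; move: f.
have cons f h : G f -> linear_span G h -> forall y, linear_span G (fun x => y * f x + h x).
  move=> Gf [n [c [e [Ge ->]]]] y; exists n.+1.
  exists (fun i => if unlift ord0 i is Some j then c j else y).
  exists (fun i => if unlift ord0 i is Some j then e j else f); split.
    by move=> i; case: unliftP.
  apply/funext => x; rewrite big_ord_recl unlift_none; congr (_ + _).
  by apply: eq_bigr => i _; rewrite liftK.
apply: linear_span_ind => [|y f h Gf IH].
  by under eq_fun do rewrite mulr0 add0r; exact: Hg.
under eq_fun do rewrite mulrDr mulrA -addrA.
exact: cons.
Qed.

Lemma linear_span_gen G f : G f -> linear_span G f.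
Proof.
move=> Gf; exists 1, (fun=> 1), (fun=> f); split=> //.
by apply/funext => x; rewrite big_ord1 mul1r.
Qed.

Lemma linear_span_mono G Q : G `<=` Q -> linear_span G `<=` linear_span Q.
Proof. by move=> GQ f [n [c [g [Gg ->]]]]; exists n, c, g; split=> // i; apply: GQ. Qed.

Lemma linear_on0 P mu : lincomb_closed P -> linear_on P mu -> mu (fun=> 0) = 0.
Proof.
move=> [P0 _] /(_ 1 _ _ P0 P0).
under eq_fun do rewrite mulr0 addr0.
by rewrite mul1r => /eqP; rewrite -subr_eq0 opprD addrA subrr add0r oppr_eq0 => /eqP.
Qed.

Lemma linear_onZ P mu z f : lincomb_closed P -> linear_on P mu -> P f ->
  mu (fun x => z * f x) = z * mu f.
Proof.
move=> cP lmu Pf; have := lmu z f _ Pf cP.1.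
by rewrite (linear_on0 cP lmu) addr0; under eq_fun do rewrite addr0.
Qed.

Lemma linear_onB P (mu : (X -> K) -> K) f g : linear_on P mu -> P f -> P g ->
  mu (fun x => g x - f x) = mu g - mu f.
Proof.
move=> lmu Pf Pg; have := lmu (-1) f g Pf Pg.
by rewrite mulN1r addrC => <-; congr mu; apply/funext => x; rewrite mulN1r addrC.
Qed.

(** Makes equality of two functionals a membership in a subspace, so that it need only be checked on
    the functions chi. *)
Lemma lincomb_closed_agree P Q mu nu : lincomb_closed P -> lincomb_closed Q ->
  linear_on P mu -> linear_on Q nu ->
  lincomb_closed [set f | [/\ P f, Q f & nu f = mu f]].
Proof.
move=> cP cQ lmu lnu; split.
  by split; [exact: cP.1|exact: cQ.1|rewrite (linear_on0 cP lmu) (linear_on0 cQ lnu)].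
move=> z f g [Pf Qf fE] [Pg Qg gE]; split; [exact: cP.2|exact: cQ.2|].
by rewrite lmu // lnu // fE gE.
Qed.

End LinearSpan.

(** * Continuity of functionals on [LAl] and growth on chi *)

Section Functionals.
Variables (R : realType) (k C : ultrametricFieldType R).
Variables (pi : k) (iota : {rmorphism k -> C}) (S : set (P1 k)).
Hypothesis iotaE : forall x, absv (iota x) = absv x.
Hypothesis Cc : complete_abs C.
Hypothesis pi_neq0 : pi != 0.
Hypothesis pi_lt1 : absv pi < 1.
Implicit Types (f g : S -> C) (a b : P1 k) (c d : nat -> C) (l j : nat).

Local Notation q := (absv pi).
Local Notation chi := (@chi R k C pi iota S).
Local Notation ballpi := (ballpi pi).
Local Notation is_centre := (is_centre pi S).
Local Notation admissible := (admissible pi S).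
Local Notation LAl := (@LAl R k C pi iota S).
Local Notation taylor_coef := (@taylor_coef R k C pi iota S).
Local Notation LAl_norm := (@LAl_norm R k C pi iota S).
Local Notation ball_decomposition := (ball_decomposition pi S).

Let q0 : 0 < q := absv_pi_gt0 pi_neq0.
Let piX0 l : pi ^+ l != 0 := piX_neq0 pi_neq0 l.
Let absv_iota_pi l : absv (iota pi ^+ l) = q ^+ l.
Proof. by rewrite absvX iotaE. Qed.

Lemma lincomb_closed_LAl l : admissible l -> lincomb_closed (LAl l).
Proof. by move=> adm; split; [exact: LAl0|move=> z f g; exact: LAl_lin]. Qed.

Lemma chi_in a l j (x : S) : ballpi a l (sval x) ->
  chi a l j x = iota (local_coord a (sval x)) ^+ j.
Proof. by move=> ax; rewrite /Defs.chi mem_set. Qed.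

Lemma chi_out a l j (x : S) : ~ ballpi a l (sval x) -> chi a l j x = 0.
Proof. by move=> ax; rewrite /Defs.chi memNset. Qed.

Lemma expansion_chi_self a l j :
  expansion iota (chi a l j) a (pi ^+ l)
    (fun n => if n == j then iota pi ^+ (l * j) else 0).
Proof.
have c0 n : (j.+1 <= n)%N -> (if n == j then iota pi ^+ (l * j) else 0) = 0.
  by case: eqP => // ->; rewrite ltnn.
apply/expansionP => //; split; first exact: nullseq_finite c0.
move=> x; rewrite -ballpiE => ax; rewrite chi_in // (power_sum_finite _ c0).
rewrite big_ord_recr /= eqxx big1 ?add0r => [|i _]; last first.
  by rewrite lt_eqF ?mul0r // ltEnat /= ltn_ord.
have piE : iota pi ^+ l = iota (pi ^+ l) by rewrite rmorphXn.
by rewrite exprM -exprMn /scaled_coord piE -rmorphM mulrC divfK.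
Qed.

Lemma expansion_chi_out a b l j : (0 < l)%N -> is_centre l a -> S b ->
  ~ ballpi a l b -> expansion iota (chi a l j) b (pi ^+ l) (fun=> 0).
Proof.
move=> l0 ca Sb nab; apply/expansionP => //; split; first exact: nullseq0.
move=> x; rewrite -ballpiE => bx.
rewrite chi_out ?(@power_sum_finite _ _ _ _ 0) ?big_ord0 // => ax.
exact/nab/(centre_ball_mem pi_neq0 pi_lt1 l0 ca Sb bx ax).
Qed.

(** At its own centre chi has the single coefficient pi^(l j), and recentring preserves the bound;
    at a point outside its ball it expands as 0. *)
Lemma expansion_chi a b l j : admissible l -> is_centre l a -> S b ->
  exists2 c, expansion iota (chi a l j) b (pi ^+ l) c &
    forall n, absv (c n) <= q ^+ (l * j).
Proof.
move=> adm ca Sb; have l0 := admissible_gt0 adm.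
case: (pselect (ballpi a l b)) => [ab|nab].
  have [d dE dB] := expansion_recentre_pi iotaE Cc pi_neq0 pi_lt1 l0 (leqnn l) ab
    (expansion_chi_self a l j).
  exists d => //; apply: dB => n; case: eqP => _; rewrite ?absv_iota_pi // absv0.
  by rewrite exprn_ge0 // ltW.
exists (fun=> 0); first exact: expansion_chi_out.
by move=> n; rewrite absv0 exprn_ge0 // ltW.
Qed.

Lemma LAl_chi a l j : admissible l -> is_centre l a -> LAl l (chi a l j).
Proof.
move=> adm ca; apply/LAlP => // b Sb.
by have [c cE _] := expansion_chi j adm ca Sb; exists c.
Qed.

Lemma LAl_norm_ge0 l D f : 0 <= LAl_norm l D f.
Proof. exact: Order.TotalTheory.bigmax_ge_id. Qed.

(** Each ball of the finer decomposition is recentred from the coarse ball containing its centre,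
    without enlarging the coefficients. *)
Lemma LAl_norm_mono l l' D D' f : (l <= l')%N -> admissible l -> admissible l' ->
  ball_decomposition l D -> ball_decomposition l' D' -> LAl l f ->
  LAl_norm l' D' f <= LAl_norm l D f.
Proof.
move=> ll adm adm' HD HD' fl.
apply: (LAl_norm_le iotaE Cc pi_neq0 pi_lt1 adm' HD'); first exact: LAl_norm_ge0.
move=> b /(decomposition_mem pi_neq0 HD') /(decomposition_cover HD)[a aD ab].
have Sa := decomposition_mem pi_neq0 HD aD.
have fa := expansion_taylor_coef iotaE Cc pi_neq0 pi_lt1 adm Sa fl.
have [d fd dB] := expansion_recentre_pi iotaE Cc pi_neq0 pi_lt1 (admissible_gt0 adm) ll ab fa.
by exists d => //; apply: dB => n; apply: taylor_coef_le_norm.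
Qed.

Lemma LAl_norm_chi l D (z : C) a j : admissible l -> ball_decomposition l D ->
  is_centre l a -> LAl_norm l D (fun x => z * chi a l j x) <= absv z * q ^+ (l * j).
Proof.
move=> adm HD ca; apply: (LAl_norm_le iotaE Cc pi_neq0 pi_lt1 adm HD).
  by rewrite mulr_ge0 ?absv_ge0 ?exprn_ge0 // ltW.
move=> b /(decomposition_mem pi_neq0 HD) Sb; have [c cE cB] := expansion_chi j adm ca Sb.
exists (fun n => z * c n).
  have := expansion_lin iotaE Cc z (piX0 l) cE (expansion0 S iotaE Cc pi_neq0 b l).
  by under eq_fun do rewrite addr0; under [X in expansion _ _ _ _ X]eq_fun do rewrite addr0.
by move=> n; rewrite absvM ler_wpM2l ?absv_ge0.
Qed.

Lemma bounded_continuous l D (nu : (S -> C) -> C) (M : R) : admissible l ->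
  ball_decomposition l D -> linear_on (LAl l) nu ->
  (forall f, LAl l f -> absv (nu f) <= M * LAl_norm l D f) ->
  LAl_continuous pi iota l nu.
Proof.
move=> adm HD lnu nuM; exists D => // f fl e e0.
have M1 : 0 < `|M| + 1 by rewrite ltr_wpDl.
exists (e / (`|M| + 1)) => [|g gl]; first exact: divr_gt0.
rewrite ltr_pdivlMr // => Hd; rewrite -(linear_onB lnu fl gl).
apply: le_lt_trans Hd; rewrite mulrC.
have gf : LAl l (fun x => g x - f x).
  have := LAl_lin iotaE Cc pi_neq0 (-1) adm fl gl.
  by congr (LAl _ _); apply/funext => x; rewrite mulN1r addrC.
apply: le_trans (nuM _ gf) _; apply: ler_wpM2r; first exact: LAl_norm_ge0.
by rewrite (le_trans (ler_norm M)) // lerDl.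
Qed.

(** Continuity at 0 with e = 1 suffices: chi scaled by z with |z| = |pi|^m / |pi|^(l j) has norm at
    most |pi|^m < d, so its image has size below 1. The resulting constant |pi|^(-m) depends neither
    on a nor on j. *)
Lemma continuous_growth l (nu : (S -> C) -> C) : admissible l ->
  linear_on (LAl l) nu -> LAl_continuous pi iota l nu ->
  exists M : R, forall a j, is_centre l a -> absv (nu (chi a l j)) <= M * q ^+ (l * j).
Proof.
move=> adm lnu [D HD /(_ _ (LAl0 iotaE Cc pi_neq0 adm) 1 ltr01)[d d0 Hd]].
have [m Hm] := expr_le_small (ltW q0) pi_lt1 (divr_gt0 d0 (ltr0Sn R 1)).
exists (q ^+ m)^-1 => a j ca.
pose z : C := iota pi ^+ m / iota pi ^+ (l * j).
have zE : absv z * q ^+ (l * j) = q ^+ m.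
  by rewrite absvM absvV !absv_iota_pi divfK // expf_neq0 // gt_eqF.
have zl : LAl l (fun x => z * chi a l j x).
  exact: (lincomb_closedZ z (lincomb_closed_LAl adm) (LAl_chi j adm ca)).
have /Hd : LAl_norm l D (fun x => z * chi a l j x - 0) < d.
  under eq_fun do rewrite subr0.
  apply: le_lt_trans (LAl_norm_chi _ _ adm HD ca) _.
  rewrite zE; apply: le_lt_trans (Hm m (leqnn m)) _.
  by rewrite ltr_pdivrMr // ltr_pMr // ltr1n.
rewrite (linear_on0 (lincomb_closed_LAl adm) lnu) subr0.
rewrite (linear_onZ _ (lincomb_closed_LAl adm) lnu (LAl_chi _ adm ca)) absvM => /(_ zl).
have qlj : 0 < q ^+ (l * j) by rewrite exprn_gt0.
have qm : 0 < q ^+ m by rewrite exprn_gt0.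
have -> : absv z = q ^+ m / q ^+ (l * j) by rewrite -zE mulfK // gt_eqF.
move=> /ltW; rewrite mulrAC ler_pdivrMr // mul1r => h.
by rewrite mulrC ler_pdivlMr // mulrC.
Qed.

Section WeightedSum.
Variables (l : nat) (D : seq (P1 k)).
Hypothesis adm : admissible l.
Hypothesis HD : ball_decomposition l D.
Hypothesis D_uniq : uniq D.
Implicit Types (w : P1 k -> nat -> C) (M : R).

Let DS a : a \in D -> S a := decomposition_mem pi_neq0 HD (a := a).

Lemma lincomb_of_local_powers (N : P1 k -> nat) (e : P1 k -> nat -> C) b (x : S) :
  b \in D -> ballpi b l (sval x) ->
  \sum_(a <- D) \sum_(i < N a) e a i * chi a l i x =
    \sum_(i < N b) e b i * iota (local_coord b (sval x)) ^+ i.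
Proof.
move=> bD bx; rewrite (bigD1_seq b) //= [X in _ + X]big_seq_cond.
rewrite [X in _ + X]big1 ?addr0 => [|a /andP[aD ab]].
  by apply: eq_bigr => i _; rewrite chi_in.
apply: big1 => i _; rewrite chi_out ?mulr0 // => ax; case/eqP: ab.
exact: (decomposition_inj HD aD bD ax bx).
Qed.

Definition weighted_sum w f : C :=
  \sum_(a <- D) tsum (fun n => taylor_coef l a f n * w a n).

Lemma weighted_sum_lin w M : (forall a n, a \in D -> absv (w a n) <= M) ->
  linear_on (LAl l) (weighted_sum w).
Proof.
move=> wM z f g fl gl; rewrite /weighted_sum mulr_sumr -big_split /=.
apply: eq_big_seq => a aD; have Sa := DS aD.
rewrite -tsum_lin //; try by apply: (nullseqMl (B := M)) => [|n];
  [exact: nullseq_taylor_coef|exact: wM].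
congr tsum; apply/funext => n; rewrite taylor_coef_lin //.
by rewrite mulrDl mulrA.
Qed.

Lemma weighted_sum_le w M f : (forall a n, a \in D -> absv (w a n) <= M) ->
  0 <= M -> LAl l f -> absv (weighted_sum w f) <= M * LAl_norm l D f.
Proof.
move=> wM M0 fl; have B0 : 0 <= M * LAl_norm l D f.
  by rewrite mulr_ge0 ?LAl_norm_ge0.
rewrite /weighted_sum big_seq; apply: absv_sum_le => // a aD.
apply: tsum_le => // [|n].
  by apply: (nullseqMl (B := M)) => [|n]; 
    [apply: nullseq_taylor_coef => //; exact: DS|exact: wM].
rewrite absvM mulrC ler_pM ?absv_ge0 ?wM //.
exact: taylor_coef_le_norm.
Qed.

Lemma taylor_coef_chi a b j : a \in D -> b \in D ->
  taylor_coef l b (chi a l j) =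
    if b == a then (fun n => if n == j then iota pi ^+ (l * j) else 0)
    else (fun=> 0).
Proof.
move=> aD bD; apply: (taylor_coefE iotaE Cc pi_neq0 pi_lt1 adm (DS bD)).
case: eqP => [->|ba]; first exact: expansion_chi_self.
apply: (expansion_chi_out j (admissible_gt0 adm) (decomposition_centre pi_neq0 HD aD) (DS bD)).
move=> ab; apply: ba.
exact: (decomposition_inj HD bD aD (ballpi_center pi_neq0 b l) ab).
Qed.

Lemma tsum_delta (w : nat -> C) (z : C) j :
  tsum (fun n => (if n == j then z else 0) * w n) = z * w j.
Proof.
rewrite (@tsum_finite _ _ _ j.+1) => [|n jn].
  rewrite big_ord_recr /= eqxx big1 ?add0r // => i _.
  by rewrite lt_eqF ?mul0r // ltEnat /= ltn_ord.
by rewrite gtn_eqF // mul0r.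
Qed.

Lemma weighted_sum_chi w a j : a \in D ->
  weighted_sum w (chi a l j) = iota pi ^+ (l * j) * w a j.
Proof.
move=> aD; rewrite /weighted_sum (bigD1_seq a) //= taylor_coef_chi // eqxx tsum_delta.
rewrite big_seq_cond big1 ?addr0 // => b /andP[bD ba].
rewrite taylor_coef_chi // (negPf ba) -[RHS](@tsum0 R C).
by congr tsum; apply/funext => n; rewrite mul0r.
Qed.

(** Isolates the term of one centre; it is applied with b = oo, where only part of the weights comes
    from the functional. *)
Lemma weighted_sum_split w w' b f : b \in D -> (forall n, w' b n = 0) ->
  (forall a, a <> b -> w a = w' a) ->
  weighted_sum w f = tsum (fun n => taylor_coef l b f n * w b n) + weighted_sum w' f.
Proof.
move=> bD w'b ww'; rewrite /weighted_sum (bigD1_seq b) //=; congr (_ + _).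
rewrite [RHS](bigD1_seq b) //= (_ : tsum _ = 0) ?add0r.
  by apply: eq_bigr => a /eqP ab; rewrite ww'.
rewrite -[RHS](@tsum0 R C).
by congr tsum; apply/funext => n; rewrite w'b mulr0.
Qed.

(** Density of locally polynomial functions: on each ball the remainder has coefficients 0 below N
    and those of f from N on. The division by pi^(l i) compensates for chi using the unscaled
    coordinate. *)
Lemma truncation_norm f N : LAl l f ->
  forall r, 0 <= r ->
  (forall a n, a \in D -> (N <= n)%N -> absv (taylor_coef l a f n) <= r) ->
  LAl_norm l D (fun x => f x -
     \sum_(a <- D) \sum_(i < N) (taylor_coef l a f i / iota pi ^+ (l * i)) * chi a l i x) <= r.
Proof.
move=> fl r r0 fr; apply: (LAl_norm_le iotaE Cc pi_neq0 pi_lt1 adm HD) => // b bD.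
have fb := expansion_taylor_coef iotaE Cc pi_neq0 pi_lt1 adm (DS bD) fl.
pose c n := if (n < N)%N then taylor_coef l b f n else 0.
pose g (x : S) := \sum_(a <- D) \sum_(i < N)
  (taylor_coef l a f i / iota pi ^+ (l * i)) * chi a l i x.
have gb : expansion iota g b (pi ^+ l) c.
  have cN n : (N <= n)%N -> c n = 0 by rewrite /c ltnNge => ->.
  apply/expansionP => //; split; first exact: nullseq_finite cN.
  move=> x; rewrite -ballpiE => bx; rewrite (power_sum_finite _ cN).
  rewrite /g; have /= -> := lincomb_of_local_powers (fun=> N)
    (fun a i => taylor_coef l a f i / iota pi ^+ (l * i)) bD bx.
  apply: eq_bigr => i _; rewrite /c ltn_ord -mulrA; congr (_ * _).
  have piE : iota pi ^+ l = iota (pi ^+ l) by rewrite rmorphXn.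
  by rewrite exprM -exprVn -exprMn piE -fmorphV -rmorphM mulrC.
exists (fun n => -1 * c n + taylor_coef l b f n).
  have := expansion_lin iotaE Cc (-1) (piX0 l) gb fb.
  congr (expansion _ _ _ _ _); apply/funext => x; by rewrite mulN1r addrC.
move=> n; rewrite /c; case: ltnP => [_|Nn]; first by rewrite mulN1r addNr absv0.
by rewrite mulr0 add0r fr.
Qed.

Lemma bounded_functional_eq (nu nu' : (S -> C) -> C) (M M' : R) :
  linear_on (LAl l) nu -> linear_on (LAl l) nu' ->
  (forall f, LAl l f -> absv (nu f) <= M * LAl_norm l D f) ->
  (forall f, LAl l f -> absv (nu' f) <= M' * LAl_norm l D f) ->
  (forall a j, a \in D -> nu (chi a l j) = nu' (chi a l j)) ->
  forall f, LAl l f -> nu f = nu' f.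
Proof.
move=> lnu lnu' nuM nuM' nuE f fl.
apply/eqP; rewrite -subr_eq0; apply/eqP/absv_small_eq => r r0.
(* A common bound for both functionals, made positive so that r / B is a legitimate tolerance. *)
pose B := `|M| + `|M'| + 1.
have B0 : 0 < B by rewrite ltr_wpDl // addr_ge0.
have e0 : 0 < r / B by rewrite divr_gt0.
have [N HN] : exists N, forall a n, a \in D -> (N <= n)%N ->
    absv (taylor_coef l a f n) <= r / B.
  (* The induction runs over a copy of [D]; the inclusion records that each entry is a point of S,
     where the Taylor coefficients of f tend to 0. *)
  have : {subset D <= D} by [].
  elim: {1 3}D => [|a s IH] sD; first by exists 0%N.
  have [|N HN] := IH; first by move=> b bs; apply: sD; rewrite inE bs orbT.
  have Sa : S a by apply/DS/sD; rewrite inE eqxx.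
  have /nullseqP /(_ _ e0)[N' HN'] := nullseq_taylor_coef iotaE Cc pi_neq0 pi_lt1 adm Sa fl.
  exists (maxn N N') => b n; rewrite inE geq_max => /predU1P[->|bs] /andP[Nn N'n].
    exact: HN'.
  exact: HN.
pose g (x : S) := \sum_(a <- D) \sum_(i < N)
  (taylor_coef l a f i / iota pi ^+ (l * i)) * chi a l i x.
have fg : LAl_norm l D (fun x => f x - g x) <= r / B := truncation_norm fl (ltW e0) HN.
have [_ gl gE] : [set h | [/\ LAl l h, LAl l h & nu' h = nu h]] g.
  have cl := lincomb_closed_LAl adm.
  have cE := lincomb_closed_agree cl cl lnu lnu'.
  apply: (lincomb_closed_sum cE) => a aD.
  apply: (lincomb_closed_sum cE) => i _; apply: lincomb_closedZ => //.
  have la : LAl l (chi a l i).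
    by apply: LAl_chi => //; apply: (decomposition_centre pi_neq0 HD aD).
  by split=> //; rewrite nuE.
have hl : LAl l (fun x => f x - g x).
  have := LAl_lin iotaE Cc pi_neq0 (-1) adm gl fl.
  by congr (LAl _ _); apply/funext => x; rewrite mulN1r addrC.
have small (eta : (S -> C) -> C) (L : R) : `|L| <= B ->
    (forall f, LAl l f -> absv (eta f) <= L * LAl_norm l D f) ->
    absv (eta (fun x => f x - g x)) <= r.
  move=> LB etaL; apply: le_trans (etaL _ hl) _.
  apply: (@le_trans _ _ (B * (r / B))); last by rewrite mulrC divfK // gt_eqF.
  apply: (@le_trans _ _ (B * LAl_norm l D (fun x => f x - g x))).
    by rewrite ler_wpM2r ?LAl_norm_ge0 // (le_trans (ler_norm L)).
  by rewrite ler_wpM2l // ltW.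
have -> : nu f - nu' f = nu (fun x => f x - g x) - nu' (fun x => f x - g x).
  by rewrite (linear_onB lnu gl fl) (linear_onB lnu' gl fl) gE opprB addrA subrK.
apply: absv_sub_le.
- by apply: small nuM; rewrite /B -addrA lerDl addr_ge0.
- by apply: small nuM'; rewrite /B -[leLHS]add0r -addrA lerD // lerDl.
Qed.

End WeightedSum.

End Functionals.

(** * A Mittag-Leffler argument *)

Lemma mittag_leffler_telescope (R : realType) (K : ultrametricFieldType R) (q : R)
    (s : nat -> nat -> K) (A : nat -> R) : 0 < q -> q < 1 ->
  (forall i n, absv (s i n) <= A i * q ^+ (i * n)) ->
  exists b : nat -> nat -> K, (forall l n, b l n = b l.+1 n + s l n) /\
    forall l, exists M : R, forall n, absv (b l n) <= M * q ^+ (l * n).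
Proof.
move=> q0 q1 sA; pose good i n := (i < n)%N && (A i * q ^+ n <= 1).
have A0 i : 0 <= A i.
  by apply: le_trans (absv_ge0 (s i 0%N)) (le_trans (sA i 0%N) _); rewrite muln0 expr0 mulr1.
(* The formal solution b_n(0) = \sum_i s_n(i) need not converge; keep only the
   terms with A_i q^n <= 1, since q^((i - l) n) then absorbs A_i for i > l. *)
exists (fun l n => \sum_(i < n | good i n) s i n - \sum_(i < l) s i n); split.
  by move=> l n; rewrite big_ord_recr /= opprD addrA subrK.
move=> l; have q_gt0 n : 0 < q ^+ n by rewrite exprn_gt0.
(* For each of the finitely many i < l only finitely many n fail to be good, so one constant covers
   all these terms. *)
have [M M0 HM] : exists2 M : R, 0 <= M & forall i n, (i < l)%N -> ~~ good i n ->
    absv (s i n) <= M * q ^+ (l * n).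
  elim: {1}l => [|m [M M0 IH]]; first by exists 0.
  have [N HN] : exists N, forall n, (N <= n)%N -> good m n.
    have Am : 0 < A m + 1 by rewrite ltr_wpDl.
    have [N HN] := expr_le_small (ltW q0) q1 (divr_gt0 (@ltr01 R) Am).
    exists (maxn m.+1 N) => n; rewrite geq_max /good => /andP[-> /HN h] /=.
    apply: (@le_trans _ _ ((A m + 1) * (1 / (A m + 1)))).
      by rewrite ler_pM ?A0 ?(ltW (q_gt0 n)) // lerDl.
    by rewrite mulrC divfK // gt_eqF.
  have B0 : 0 <= \sum_(n < N) absv (s m n) / q ^+ (l * n).
    by apply: sumr_ge0 => n _; rewrite divr_ge0 ?absv_ge0 // ltW.
  exists (M + \sum_(n < N) absv (s m n) / q ^+ (l * n)); first exact: addr_ge0.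
  move=> i n; rewrite ltnS leq_eqVlt => /predU1P[->|im] ng; last first.
    by apply: le_trans (IH i n im ng) _; rewrite ler_pM2r // lerDl.
  have nN : (n < N)%N by rewrite ltnNge; apply: contra ng => /HN.
  rewrite -ler_pdivrMr // (bigD1 (Ordinal nN)) //= addrCA lerDl addr_ge0 //.
  by apply: sumr_ge0 => j _; rewrite divr_ge0 ?absv_ge0 // ltW.
(* M serves the terms i < l that are not good, A l the term i = l, and 1 the good terms i > l. *)
exists (M + A l + 1) => n; set B := _ * _.
have le_B x : x <= M + A l + 1 -> x * q ^+ (l * n) <= B by rewrite /B ler_pM2r.
have B0 : 0 <= B by rewrite /B mulr_ge0 ?addr_ge0 ?A0 ?ler01 // ltW.
(* Over a common range the good terms with i < l cancel; what survives is the bad terms with i < l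
   and the good ones with i >= l. *)
rewrite (big_ord_widen_cond (n + l) (good^~ n) (fun i => s i n)) ?leq_addr //.
rewrite (big_ord_widen_cond (n + l) xpredT (fun i => s i n)) ?leq_addl //.
rewrite big_mkcond [X in _ - X]big_mkcond /= -sumrB.
apply: absv_sum_le => // i _.
have good_lt : good i n -> (i < n)%N by case/andP.
case gi: (good i n) => /=; last first.
  rewrite sub0r absvN; case: ltnP => [il|_]; last by rewrite absv0.
  apply: le_trans (HM i n il _) (le_B _ _); first by rewrite gi.
  by rewrite -addrA lerDl addr_ge0.
rewrite good_lt //; case: ltnP => [_|li]; first by rewrite subrr absv0.
rewrite subr0; have [<-|ll] := eqVneq l i.
  apply: le_trans (sA l n) (le_B _ _).
  by rewrite addrAC lerDr addr_ge0.
apply: le_trans (sA i n) _; apply: (@le_trans _ _ (1 * q ^+ (l * n))); last first.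
  by apply: le_B; rewrite lerDr addr_ge0.
have li' : (l < i)%N by rewrite ltn_neqAle ll.
have E : q ^+ (i * n) = q ^+ n * q ^+ ((i.-1 - l) * n) * q ^+ (l * n).
  by rewrite -!exprD -mulSn -mulnDl -subSn ?prednK ?subnK //; lia.
move: gi => /andP[_ gi]; rewrite E !mulrA ler_pM2r //.
rewrite -[leRHS]mulr1 ler_pM ?mulr_ge0 ?(ltW (q_gt0 _)) // exprn_ile1 ?ltW //.
Qed.

Lemma poly_infinite_roots (F : fieldType) (p : {poly F}) (x : nat -> F) :
  injective x -> (forall m, root p (x m)) -> p = 0.
Proof.
move=> xi px; apply: (@roots_geq_poly_eq0 _ p [seq x i | i <- iota 0 (size p)]).
- by apply/allP => _ /mapP[m _ ->].
- by rewrite map_inj_uniq ?iota_uniq.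
- by rewrite size_map size_iota.
Qed.

Lemma poly_inv_eq_poly_size (F : fieldType) (p r : {poly F}) (x : nat -> F) :
  injective x -> (forall m, x m != 0) ->
  (forall m, p.[(x m)^-1] = r.[x m]) -> (size p <= 1)%N.
Proof.
move=> xi x0 E; pose n := size p.
(* t is X^n p(1/X) with n = deg p + 1 (if p != 0); it equals X^n r, whence
   deg r <= 0. *)
pose t := \sum_(i < n) p`_i *: 'X^(n - i).
have tE : t = 'X^n * r.
  apply/eqP; rewrite -subr_eq0; apply/eqP/(poly_infinite_roots xi) => m.
  rewrite /root hornerD hornerN hornerM hornerXn -E (horner_coef p) mulr_sumr.
  rewrite /t horner_sum subr_eq0; apply/eqP/eq_bigr => i _.
  rewrite hornerZ hornerXn mulrCA; congr (_ * _).
  by rewrite exprVn expfB_cond // (negPf (x0 m)) add0n ltnW.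
have r1 : (size r <= 1)%N.
  have [->|rn0] := eqVneq r 0; first by rewrite size_poly0.
  have : (size t <= n.+1)%N.
    apply: leq_trans (size_sum _ _ _) _; apply/bigmax_leqP => i _.
    rewrite (leq_trans (size_scale_leq _ _)) //.
    by rewrite size_polyXn ltnS leq_subr.
  by rewrite tE mulrC size_mulXn // -addn1 leq_add2l.
have rE := size1_polyC r1.
suff -> : p = (r`_0)%:P by rewrite size_polyC leq_b1.
apply/eqP; rewrite -subr_eq0; apply/eqP.
apply: (@poly_infinite_roots _ _ (fun m => (x m)^-1)) => [m m' /invr_inj /xi //|m].
by rewrite /root hornerD hornerN hornerC E {1}rE hornerC subrr.
Qed.

(** * Locally polynomial functions *)

Section LocalPolynomials.
Variables (R : realType) (k C : ultrametricFieldType R).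
Variables (pi : k) (iota : {rmorphism k -> C}) (S : set (P1 k)).
Hypothesis pi_neq0 : pi != 0.
Hypothesis pi_lt1 : absv pi < 1.
Implicit Types (f g : S -> C) (a b : P1 k) (l j n : nat) (p : {poly C}).

Local Notation q := (absv pi).
Local Notation chi := (@chi R k C pi iota S).
Local Notation ballpi := (ballpi pi).
Local Notation is_centre := (is_centre pi S).
Local Notation admissible := (admissible pi S).
Local Notation ball_decomposition := (ball_decomposition pi S).

Definition locally_poly l b f p : Prop := forall x : S,
  ballpi b l (sval x) -> f x = p.[iota (local_coord b (sval x))].

Lemma centre_mem l a : is_centre l a -> S a.
Proof. by case=> aS _; apply: aS; apply: ballpi_center. Qed.

(* [T] is [True] when l = l' and [False] otherwise: only in the first case is
   chi(oo,l;j), j > 0, polynomial in the local coordinates of level l'. *)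
Lemma chi_locally_poly (T : Prop) l l' a b j : (0 < l)%N -> (l <= l')%N ->
  (T -> l = l') -> is_centre l a -> is_centre l' b ->
  [\/ a <> None, j = 0%N | T] ->
  exists p, [/\ locally_poly l' b (chi a l j) p, (size p <= j.+1)%N &
    forall i, p`_i != 0 -> [\/ b <> None, i = 0%N | T]].
Proof.
move=> l0 ll Tl ca cb nice.
have Sb := centre_mem cb.
case: (pselect (ballpi a l b)) => [ab|nab]; last first.
  exists 0; split=> [x bx||i]; rewrite ?size_poly0 ?coef0 ?eqxx // horner0.
  apply: chi_out => ax; apply: nab.
  apply: (centre_ball_mem pi_neq0 pi_lt1 l0 ca Sb _ ax).
  exact: (ballpi_recentre pi_neq0 pi_lt1 l0 ll (ballpi_center pi_neq0 b l) bx).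
have chiE x : ballpi b l' (sval x) -> chi a l j x = iota (local_coord a (sval x)) ^+ j.
  by move=> bx; apply/chi_in/(ballpi_recentre pi_neq0 pi_lt1 l0 ll ab bx).
case: a b ca cb Sb ab nice chiE => [a|] [b|] ca cb Sb ab nice chiE //.
- exists (('X + (iota (b - a))%:P) ^+ j); split.
  + move=> x bx; rewrite chiE // horner_exp hornerD hornerX hornerC -rmorphD.
    case: (sval x) bx => // y _; congr (iota _ ^+ _) => /=; ring.
  + by rewrite (leq_trans (size_poly_exp_leq _ _)) // size_XaddC mul1n.
  + by move=> i _; apply: Or31.
- case: nice => // [j0|/Tl E].
    exists 1; split=> [x bx||i _]; rewrite ?size_poly1 //; last exact: Or31.
    by rewrite chiE // j0 expr0 hornerC.
  (* Here l = l', and a finite centre of that level cannot lie in the ball at oo. *)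
  have [//|[]] := cb.2 (ca.1 _ (ballpi_center pi_neq0 _ _)).
  by rewrite -E.
- exists 'X^j; split=> [x bx||i]; rewrite ?size_polyXn //.
    by rewrite chiE // hornerXn.
  rewrite coefXn; case: (i =P j) => [->|_]; last by rewrite eqxx.
  by case: nice => // H _; [apply: Or32|apply: Or33].
Qed.

Lemma Pln_locally_poly l n f b : (0 < l)%N -> Pln pi iota l n f -> is_centre l b ->
  exists p, locally_poly l b f p.
Proof.
move=> l0 + cb; move: f; apply: linear_span_ind.
  by exists 0 => x _; rewrite horner0.
move=> z _ g [a [j [ca _ ->]]] [r gr].
have [||p [fp _ _]] := @chi_locally_poly True l l a b j l0 (leqnn l) _ ca cb.
- by [].
- by apply: Or33.
exists (z *: p + r) => x bx.
by rewrite hornerD hornerZ -fp // -gr.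
Qed.

Lemma locally_poly_sum l D f (p : P1 k -> {poly C}) : ball_decomposition l D -> uniq D ->
  (forall b, b \in D -> locally_poly l b f (p b)) ->
  f = fun x => \sum_(b <- D) \sum_(i < size (p b)) (p b)`_i * chi b l i x.
Proof.
move=> HD uD fp; apply/funext => x.
have Sx : S (sval x) by apply: set_mem; apply: (valP x).
have [b bD bx] := decomposition_cover HD Sx.
have := lincomb_of_local_powers iota HD uD (fun b => size (p b)) (fun b i => (p b)`_i) bD bx.
by move=> /= ->; rewrite -horner_coef (fp b bD x bx).
Qed.

Lemma locally_poly_mem (E : set (S -> C)) l D f (p : P1 k -> {poly C}) :
  lincomb_closed E -> ball_decomposition l D -> uniq D ->
  (forall b, b \in D -> locally_poly l b f (p b)) ->
  (forall b i, b \in D -> (p b)`_i != 0 -> E (chi b l i)) -> E f.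
Proof.
move=> cE HD uD fp chiE; rewrite (locally_poly_sum HD uD fp).
apply: (lincomb_closed_sum cE) => b bD; apply: (lincomb_closed_sum cE) => i _.
have [->|nz] := eqVneq (p b)`_i 0.
  by under eq_fun do rewrite mul0r; exact: cE.1.
by apply: lincomb_closedZ => //; apply: chiE.
Qed.

Lemma Pln_mono l n n' : (n <= n')%N -> @Pln _ _ _ pi iota S l n `<=` Pln pi iota l n'.
Proof.
move=> nn; apply: linear_span_mono => _ [a [j [ca jn ->]]].
by exists a, j; split=> //; apply: leq_trans nn.
Qed.

Lemma lincomb_closed_Plinf l : lincomb_closed (Plinf pi iota S l).
Proof.
split; first by exists 0%N => //; exact: (lincomb_closed_span _).1.
move=> z f g [n _ fn] [m _ gm]; exists (maxn n m) => //.
apply: (lincomb_closed_span _).2.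
- exact: Pln_mono (leq_maxl n m) _ fn.
- exact: Pln_mono (leq_maxr n m) _ gm.
Qed.

Lemma lincomb_closed_Pinf : lincomb_closed (Pinf pi iota S).
Proof.
split.
  by exists 0%N => //; exists 0%N => // l _; exact: (lincomb_closed_span _).1.
move=> z f g [n _ [N _ fN]] [m _ [M _ gM]]; exists (maxn n m) => //.
exists (maxn N M) => // l /=; rewrite geq_max => /andP[Nl Ml].
apply: (lincomb_closed_span _).2.
- exact: Pln_mono (leq_maxl n m) _ (fN l Nl).
- exact: Pln_mono (leq_maxr n m) _ (gM l Ml).
Qed.

Lemma chi_Plinf l a j : is_centre l a -> Plinf pi iota S l (chi a l j).
Proof. by move=> ca; exists j => //; apply: linear_span_gen; exists a, j. Qed.

(** A polynomial in x - a, or a constant, restricts to every smaller ball as a polynomial of degree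
    at most j in the new coordinate, so chi remains in the same [Pln] bound j at all finer
    levels. *)
Lemma chi_Pinf l a j : compact S -> (forall l', (l <= l')%N -> admissible l') ->
  is_centre l a -> a <> None \/ j = 0%N -> Pinf pi iota S (chi a l j).
Proof.
move=> cS adm ca nice; exists j => //; exists l => // l' /= ll.
have adm' := adm l' ll.
have [D uD HD] := decomposition_exists pi_neq0 pi_lt1 cS adm'.
have l0 := admissible_gt0 (adm l (leqnn l)).
have nice3 : [\/ a <> None, j = 0%N | False].
  by case: nice => ?; [apply: Or31|apply: Or32].
have /choice[p Hp] : forall b, exists p, b \in D ->
    locally_poly l' b (chi a l j) p /\ (size p <= j.+1)%N.
  move=> b; case: (boolP (b \in D)) => [bD|_]; last by exists 0.
  have cb := decomposition_centre pi_neq0 HD bD.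
  have [//|p [Hp sp _]] := chi_locally_poly l0 ll _ ca cb nice3.
  by exists p.
apply: (locally_poly_mem (p := p) (lincomb_closed_span _) HD uD).
  by move=> b /Hp[].
move=> b i bD nz; apply: linear_span_gen; exists b, i; split=> //.
  exact: (decomposition_centre pi_neq0 HD bD).
have [_ sp] := Hp b bD; rewrite -ltnS (leq_trans _ sp) // ltnNge.
by apply: contra nz => h; rewrite nth_default.
Qed.

(** At level l the function is a polynomial in 1/x on the ball at oo; at level l + 1 it is a
    polynomial in x on a finite ball inside that ball. Comparing the two there leaves only the
    constant term. *)
Lemma Pinf_locally_poly f : (exists L, forall l, (L <= l)%N -> admissible l) ->
  Pinf pi iota S f ->
  exists L, forall l, (L <= l)%N -> forall b, is_centre l b ->
    exists p, locally_poly l b f p /\ forall i, p`_i != 0 -> b <> None \/ i = 0%N.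
Proof.
move=> [L0 adm] [n _ [N _ fN]]; exists (maxn L0 N) => l.
rewrite geq_max => /andP[/adm /admissible_gt0 l0 Nl] b cb.
have [p fp] := Pln_locally_poly l0 (fN l Nl) cb.
exists p; split=> // i pi_neq; case: b cb fp => [b|] cb fp; [by left|right].
have q_gt0 := absv_pi_gt0 pi_neq0.
(* This point lies on the boundary |x| = |pi|^(-l) of the ball at oo, hence outside the ball of
   level l + 1, and can be a finite centre there. *)
pose c : k := pi ^- l; pose b : P1 k := Some c.
have bN : ballpi None l b by rewrite /Defs.ballpi /= absvV absvX.
have bs : ballpi b l.+1 `<=` ballpi None l.
  exact: (ballpi_recentre pi_neq0 pi_lt1 l0 (leqnSn l) bN).
have cb' : is_centre l.+1 b.
  split; first exact: subset_trans bs cb.1.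
  move=> _; right; rewrite /Defs.ballpi /= absvV absvX lef_pV2 ?posrE ?exprn_gt0 //.
  by rewrite ler_iXn2l // ltnn.
have [r fr] := Pln_locally_poly (ltn0Sn l) (fN _ (leqW Nl)) cb'.
(* Infinitely many points of the finite ball, distinct because their distances to c are distinct
   powers of |pi|. *)
pose x m : k := c + pi ^+ (l.+1 + m).
have bx m : ballpi b l.+1 (Some (x m)).
  rewrite /Defs.ballpi /= /x addrAC subrr add0r absvX.
  by rewrite ler_iXn2l // leq_addr.
have x0 m : x m != 0.
  apply/eqP => E; have := bs _ (bx m); rewrite E /Defs.ballpi /= absv0.
  by rewrite leNgt invr_gt0 exprn_gt0.
have xi : injective (fun m => iota (x m)).
  move=> m m' /fmorph_inj /addrI E; apply/eqP; rewrite -(eqn_add2l l.+1); apply/eqP.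
  move/(congr1 (@absv R k)): E; rewrite !absvX.
  by apply: ieexprIn; rewrite ?lt_eqF.
have : (size p <= 1)%N.
  apply: (@poly_inv_eq_poly_size _ p (r \Po ('X - (iota c)%:P)) (fun m => iota (x m))) => //.
    by move=> m; rewrite fmorph_eq0.
  move=> m; rewrite horner_comp hornerD hornerN hornerX hornerC -rmorphB -fmorphV.
  pose y : S := exist _ (Some (x m)) (mem_set (cb.1 _ (bs _ (bx m)))).
  by rewrite -(fp y (bs _ (bx m))) -(fr y (bx m)).
move=> sp; case: i pi_neq => // i; rewrite nth_default ?eqxx //.
by rewrite (leq_trans sp).
Qed.

End LocalPolynomials.

(** * Extension of functionals *)

Section Extension.
Variables (R : realType) (k C : ultrametricFieldType R).
Variables (pi : k) (iota : {rmorphism k -> C}) (S : set (P1 k)).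
Hypothesis iotaE : forall x, absv (iota x) = absv x.
Hypothesis Cc : complete_abs C.
Hypothesis pi_neq0 : pi != 0.
Hypothesis pi_lt1 : absv pi < 1.
Hypothesis S_compact : compact S.
Implicit Types (f g : S -> C) (a b : P1 k) (l j n : nat) (mu : (S -> C) -> C).

Local Notation q := (absv pi).
Local Notation chi := (@chi R k C pi iota S).
Local Notation ballpi := (ballpi pi).
Local Notation is_centre := (is_centre pi S).
Local Notation admissible := (admissible pi S).
Local Notation LAl := (@LAl R k C pi iota S).
Local Notation LAl_norm := (@LAl_norm R k C pi iota S).
Local Notation ball_decomposition := (ball_decomposition pi S).
Local Notation weighted_sum := (@weighted_sum R k C pi iota S).
Local Notation taylor_coef := (@taylor_coef R k C pi iota S).

Let q0 : 0 < q := absv_pi_gt0 pi_neq0.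
Let iota_pi0 l : iota pi ^+ l != 0.
Proof. by rewrite -rmorphXn fmorph_eq0 expf_neq0. Qed.

Lemma integral_over_chi mu a l j :
  integral_over (ballpi a l) mu (chi a l j) = Defs.integral mu (chi a l j).
Proof.
rewrite /integral_over /Defs.integral; congr mu; apply/funext => x.
rewrite indicE; case: (boolP (sval x \in ballpi a l)) => [_|h]; first by rewrite mulr1.
by rewrite mulr0 /Defs.chi (negPf h).
Qed.

Lemma growth_boundP (P : set (S -> C)) l mu M :
  growth_bound pi iota P l mu M <->
  (forall a j, is_centre l a -> P (chi a l j) -> absv (mu (chi a l j)) <= M * q ^+ (l * j)).
Proof.
split=> [H a j ca Pa|H j a ca Pa]; first by have [] := H j a ca Pa.
by rewrite integral_over_chi; split=> //; apply: H.
Qed.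

Lemma normalized_weight_le (z : C) M l n : absv z <= M * q ^+ (l * n) ->
  absv (z / iota pi ^+ (l * n)) <= M.
Proof.
by move=> h; rewrite absvM absvV absvX iotaE ler_pdivrMr // exprn_gt0.
Qed.

Lemma extension_at_level l mu : admissible l -> linear_on (Plinf pi iota S l) mu ->
  (exists2 nu, LAl_dual pi iota S l nu & extends (Plinf pi iota S l) nu mu) <->
  (exists M : R, growth_bound pi iota (Plinf pi iota S l) l mu M).
Proof.
move=> adm lmu; have l0 := admissible_gt0 adm; split.
  case=> nu [lnu cnu] numu.
  have [M HM] := continuous_growth iotaE Cc pi_neq0 pi_lt1 adm lnu cnu.
  by exists M; apply/growth_boundP => a j ca Pa; rewrite -numu // HM.
case=> M /growth_boundP HM.
have [D uD HD] := decomposition_exists pi_neq0 pi_lt1 S_compact adm.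
pose w a n := mu (chi a l n) / iota pi ^+ (l * n).
have wM a n : a \in D -> absv (w a n) <= `|M|.
  move=> /(decomposition_centre pi_neq0 HD) ca; apply: le_trans (ler_norm M).
  by apply/normalized_weight_le/HM => //; apply: chi_Plinf.
have lw := weighted_sum_lin iotaE Cc pi_neq0 pi_lt1 adm HD wM.
exists (weighted_sum l D w).
  split=> //; apply: (bounded_continuous iotaE Cc pi_neq0 adm HD lw).
  exact: (fun f => weighted_sum_le iotaE Cc pi_neq0 pi_lt1 adm HD wM (normr_ge0 M)).
move=> f [n _ fn].
have cE := lincomb_closed_agree (lincomb_closed_Plinf pi iota S l)
  (lincomb_closed_LAl iotaE Cc pi_neq0 adm) lmu lw.
have /choice[p Hp] : forall b, exists p, b \in D -> locally_poly pi iota l b f p.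
  move=> b; case: (boolP (b \in D)) => [bD|_]; last by exists 0.
  have [p Hp] := Pln_locally_poly pi_neq0 pi_lt1 l0 fn (decomposition_centre pi_neq0 HD bD).
  by exists p.
have [] // := locally_poly_mem cE HD uD Hp.
move=> b i bD _; have cb := decomposition_centre pi_neq0 HD bD.
split; [exact: chi_Plinf|exact: LAl_chi|].
by rewrite (weighted_sum_chi iotaE Cc pi_neq0 pi_lt1 adm HD uD) // mulrC divfK.
Qed.

(** * Compatible functionals on all levels and their limit *)

Section Inductive_limit.
Variables (L : nat) (mu : (S -> C) -> C).
Hypothesis adm : forall l, (L <= l)%N -> admissible l.
Hypothesis lmu : linear_on (Pinf pi iota S) mu.
Variables (D : nat -> seq (P1 k)) (M : nat -> R).
Hypothesis D_uniq : forall l, (L <= l)%N -> uniq (D l).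
Hypothesis HD : forall l, (L <= l)%N -> ball_decomposition l (D l).
Hypothesis M_ge0 : forall l, 0 <= M l.
Hypothesis HM : forall l, (L <= l)%N -> forall a j, is_centre l a ->
  Pinf pi iota S (chi a l j) -> absv (mu (chi a l j)) <= M l * q ^+ (l * j).

(** Suppressing every weight at oo confines the evaluation of chi(oo,l;n) at level l + 1 to the part
    of its ball outside the next ball at oo. *)
Definition finite_weight l a n : C :=
  if a is None then 0 else mu (chi a l n) / iota pi ^+ (l * n).

Lemma chi_Pinf_above l a j : (L <= l)%N -> is_centre l a -> a <> None \/ j = 0%N ->
  Pinf pi iota S (chi a l j).
Proof.
move=> Ll; apply: chi_Pinf => // l' ll; exact: adm (leq_trans Ll ll).
Qed.

Lemma finite_weight_le l a n : (L <= l)%N -> a \in D l -> absv (finite_weight l a n) <= M l.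
Proof.
move=> Ll aD; have ca := decomposition_centre pi_neq0 (HD Ll) aD.
case: a aD ca => [a|] aD ca; last by rewrite absv0.
apply/normalized_weight_le/HM => //; apply: chi_Pinf_above => //; by left.
Qed.

(** The s_n(l) of the telescoping relation. The value 0 below L, or when oo is not in S, lets the
    bound hold for every l, as the Mittag-Leffler lemma requires. *)
Definition shell l n : C :=
  if (L <= l)%N && `[< S None >] then
    weighted_sum l.+1 (D l.+1) (finite_weight l.+1) (chi None l n)
  else 0.

Lemma centre_None l : (L <= l)%N -> S None -> is_centre l None.
Proof. by move=> Ll SN; split; [have [_] := adm Ll; apply|left]. Qed.

(** The weights live at level l + 1, whence M l.+1; the norm of chi(oo,l;n) at that level is at most
    its norm at level l, whence the exponent l n. *)
Lemma shell_le l n : absv (shell l n) <= M l.+1 * q ^+ (l * n).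
Proof.
rewrite /shell; case: ifP => [/andP[Ll /asboolP SN]|_]; last first.
  by rewrite absv0 mulr_ge0 ?exprn_ge0 // ltW.
have Ll1 := leqW Ll; have cN := centre_None Ll SN.
have lchi := LAl_chi iotaE Cc pi_neq0 pi_lt1 n (adm Ll) cN.
have lchi1 := LAl_mono pi_neq0 pi_lt1 (leqnSn l) lchi.
apply: le_trans (weighted_sum_le iotaE Cc pi_neq0 pi_lt1 (adm Ll1) (HD Ll1) _ _ lchi1) _ => //.
  by move=> a m; apply: finite_weight_le.
apply: ler_wpM2l => //.
apply: le_trans (LAl_norm_mono iotaE Cc pi_neq0 pi_lt1 (leqnSn l)
  (adm Ll) (adm Ll1) (HD Ll) (HD Ll1) lchi) _.
have := LAl_norm_chi iotaE Cc pi_neq0 pi_lt1 1 n (adm Ll) (HD Ll) cN.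
by rewrite absv1 mul1r; under eq_fun do rewrite mul1r.
Qed.

Variable b : nat -> nat -> C.
Hypothesis bE : forall l n, b l n = b l.+1 n + shell l n.
Hypothesis b_le : forall l, exists B : R, forall n, absv (b l n) <= B * q ^+ (l * n).

(** At oo the constant function on the ball is in the domain of mu, so n = 0 still uses mu; only the
    positive powers of 1/x use the solution b. *)
Definition weight l a n : C :=
  if (a == None) && (n != 0%N) then b l n / iota pi ^+ (l * n)
  else mu (chi a l n) / iota pi ^+ (l * n).

Lemma weight_le l : (L <= l)%N ->
  exists2 W : R, 0 <= W & forall a n, a \in D l -> absv (weight l a n) <= W.
Proof.
move=> Ll; have [B HB] := b_le l.
exists (M l + `|B|) => [|a n aD]; first by rewrite addr_ge0.
have ca := decomposition_centre pi_neq0 (HD Ll) aD.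
rewrite /weight; case: ifP => [_|H].
  apply: le_trans (normalized_weight_le (HB n)) _.
  by rewrite (le_trans (ler_norm B)) // lerDr.
apply: (@le_trans _ _ (M l)); last by rewrite lerDl.
apply/normalized_weight_le/HM => //; apply: chi_Pinf_above => //.
move/negbT: H; rewrite negb_and negbK => /orP[/eqP|/eqP]; [by left|by right].
Qed.

Definition level_functional l := weighted_sum l (D l) (weight l).

Lemma level_functional_lin l : (L <= l)%N -> linear_on (LAl l) (level_functional l).
Proof.
move=> Ll; have [W _ HW] := weight_le Ll.
exact: (weighted_sum_lin iotaE Cc pi_neq0 pi_lt1 (adm Ll) (HD Ll) HW).
Qed.

Lemma level_functional_le l : (L <= l)%N -> exists2 W : R, 0 <= W &
  forall f, LAl l f -> absv (level_functional l f) <= W * LAl_norm l (D l) f.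
Proof.
move=> Ll; have [W W0 HW] := weight_le Ll; exists W => // f fl.
exact: (weighted_sum_le iotaE Cc pi_neq0 pi_lt1 (adm Ll) (HD Ll) HW W0 fl).
Qed.

Let agree l := [set f | [/\ Pinf pi iota S f, LAl l f & level_functional l f = mu f]].

Let agree_closed l : (L <= l)%N -> lincomb_closed (agree l).
Proof.
move=> Ll; apply: lincomb_closed_agree => //.
- exact: lincomb_closed_Pinf.
- exact: (lincomb_closed_LAl iotaE Cc pi_neq0 (adm Ll)).
- exact: level_functional_lin.
Qed.

Lemma level_functional_chi_self l a i : (L <= l)%N -> a \in D l ->
  level_functional l (chi a l i) = iota pi ^+ (l * i) * weight l a i.
Proof.
move=> Ll aD.
exact: (weighted_sum_chi iotaE Cc pi_neq0 pi_lt1 (adm Ll) (HD Ll) (D_uniq Ll)).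
Qed.

Lemma agree_chi l a i : (L <= l)%N -> a \in D l -> a <> None \/ i = 0%N ->
  agree l (chi a l i).
Proof.
move=> Ll aD nice; have ca := decomposition_centre pi_neq0 (HD Ll) aD.
split; [exact: chi_Pinf_above|exact: (LAl_chi iotaE Cc pi_neq0 pi_lt1 _ (adm Ll))|].
rewrite level_functional_chi_self // /weight ifF ?(mulrC (_ ^+ _)) ?divfK //.
by case: nice => [/eqP/negPf ->|->] //; rewrite eqxx andbF.
Qed.

(** Finite additivity: at level l' this chi is a combination of functions chi(c,l';i) with c finite
    or i = 0, on which the weights reproduce mu. *)
Lemma level_functional_chi l l' a j : (L <= l)%N -> (l <= l')%N -> is_centre l a ->
  a <> None \/ j = 0%N -> level_functional l' (chi a l j) = mu (chi a l j).
Proof.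
move=> Ll ll ca nice; have Ll' := leq_trans Ll ll.
have nice3 : [\/ a <> None, j = 0%N | False].
  by case: nice => ?; [apply: Or31|apply: Or32].
have /choice[p Hp] : forall c, exists p, c \in D l' ->
    locally_poly pi iota l' c (chi a l j) p /\ (forall i, p`_i != 0 -> c <> None \/ i = 0%N).
  move=> c; case: (boolP (c \in D l')) => [cD|_]; last by exists 0.
  have cc := decomposition_centre pi_neq0 (HD Ll') cD.
  have [//|p [Hp _ nz]] := chi_locally_poly iota pi_neq0 pi_lt1
    (admissible_gt0 (adm Ll)) ll _ ca cc nice3.
  by exists p => _; split=> // i /nz[]; [left|right|].
have [] // := locally_poly_mem (agree_closed Ll') (HD Ll') (D_uniq Ll')
  (fun c cD => (Hp c cD).1).
by move=> c i cD nz; apply: agree_chi => //; apply: (Hp c cD).2.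
Qed.

Lemma expansion_chi_None l l' j : (0 < l)%N -> (l <= l')%N ->
  expansion iota (chi None l j) None (pi ^+ l')
    (fun n => if n == j then iota pi ^+ (l' * j) else 0).
Proof.
move=> l0 ll; have piX := piX_neq0 pi_neq0 l'.
have /(expansionP iotaE Cc _ _ _ piX)[c0 E] := expansion_chi_self S iotaE Cc pi_neq0 None l' j.
apply/(expansionP iotaE Cc _ _ _ piX); split=> // x xN; rewrite -E //.
have xN' : ballpi None l' (sval x) by rewrite ballpiE.
have xN'' : ballpi None l (sval x).
  exact: (ballpi_recentre pi_neq0 pi_lt1 l0 ll (ballpi_center pi_neq0 None l)).
by rewrite !chi_in.
Qed.

(** Both sides are bounded for the norm of level l, because norms decrease with the level; by
    density it is enough to compare them on the functions chi of level l. *)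
Lemma level_functional_step l f : (L <= l)%N -> LAl l f ->
  level_functional l f = level_functional l.+1 f.
Proof.
move=> Ll; have Ll1 := leqW Ll.
have [W W0 HW] := level_functional_le Ll; have [W' W'0 HW'] := level_functional_le Ll1.
have lmono := LAl_mono (S := S) (iota := iota) pi_neq0 pi_lt1 (leqnSn l).
apply: (bounded_functional_eq iotaE Cc pi_neq0 pi_lt1 (adm Ll) (HD Ll) (D_uniq Ll)
  (level_functional_lin Ll) _ HW (M' := W')).
- by move=> z g h /lmono gl /lmono hl; apply: level_functional_lin.
- move=> g gl; apply: le_trans (HW' g (lmono g gl)) _; apply: ler_wpM2l => //.
  exact: (LAl_norm_mono iotaE Cc pi_neq0 pi_lt1 (leqnSn l)
    (adm Ll) (adm Ll1) (HD Ll) (HD Ll1)).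
move=> a j aD; have ca := decomposition_centre pi_neq0 (HD Ll) aD.
case: (pselect (a <> None \/ j = 0%N)) => [nice|nnice].
  by rewrite !(level_functional_chi Ll _ ca).
have aN : a = None by apply: contrapT => h; apply: nnice; left.
have j0 : j != 0%N by apply/eqP => h; apply: nnice; right.
subst a; have SN := decomposition_mem pi_neq0 (HD Ll) aD.
have ND1 : None \in D l.+1.
  by have [[c|] //] := decomposition_cover (HD Ll1) SN.
(* The remaining case is chi(oo,l;j) with j > 0. Level l gives b l j; level l + 1 gives b l.+1 j
   from the ball at oo plus the shell from the finite centres, and [bE] equates them. *)
rewrite level_functional_chi_self // /weight eqxx j0 /= mulrC divfK //.
rewrite /level_functional.
rewrite (weighted_sum_split pi iota l.+1 (D_uniq Ll1)
  (w' := finite_weight l.+1) _ ND1) //; last first.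
  by move=> [a|] // _; apply/funext => n; rewrite /weight.
rewrite (taylor_coefE iotaE Cc pi_neq0 pi_lt1 (adm Ll1) SN
  (expansion_chi_None j (admissible_gt0 (adm Ll)) (leqnSn l))).
rewrite tsum_delta /weight eqxx j0 /= [_ * (_ / _)]mulrC divfK // bE; congr (_ + _).
by rewrite /shell Ll (asboolT SN).
Qed.

Lemma level_functional_mono l l' f : (L <= l)%N -> (l <= l')%N -> LAl l f ->
  level_functional l f = level_functional l' f.
Proof.
move=> Ll /subnK <- fl; elim: (l' - l)%N => // n IH.
rewrite IH addSn; apply: level_functional_step; first by rewrite (leq_trans Ll) // leq_addl.
exact: (LAl_mono pi_neq0 pi_lt1 (leq_addl n l) fl).
Qed.

(** The level is any one at which f is analytic; [level_functional_mono] makes the value independent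
    of this choice. *)
Definition limit_functional f : C :=
  level_functional (xget L [set l | (L <= l)%N /\ LAl l f]) f.

Lemma limit_functionalE l f : (L <= l)%N -> LAl l f ->
  limit_functional f = level_functional l f.
Proof.
move=> Ll fl; rewrite /limit_functional.
have [] := @xgetPex _ L [set l | (L <= l)%N /\ LAl l f] (ex_intro _ l (conj Ll fl)).
set m := xget _ _ => Lm fm.
case: (leqP l m) => [lm|/ltnW ml].
  by rewrite (level_functional_mono Ll lm fl).
by rewrite (level_functional_mono Lm ml fm).
Qed.


Lemma limit_functional_lin : linear_on (@LA _ _ _ iota S) limit_functional.
Proof.
move=> z f g /(LA_LAl iotaE Cc pi_neq0 pi_lt1 S_compact)[N fN].
move=> /(LA_LAl iotaE Cc pi_neq0 pi_lt1 S_compact)[N' gN].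
pose l := maxn L (maxn N N').
have Ll : (L <= l)%N by rewrite leq_maxl.
have fl : LAl l f by apply: fN; rewrite /l; lia.
have gl : LAl l g by apply: gN; rewrite /l; lia.
have fgl := LAl_lin iotaE Cc pi_neq0 z (adm Ll) fl gl.
rewrite !(limit_functionalE Ll) //; exact: level_functional_lin.
Qed.

Lemma limit_functional_continuous l : (L <= l)%N ->
  LAl_continuous pi iota l limit_functional.
Proof.
move=> Ll; have [W W0 HW] := level_functional_le Ll.
have lin : linear_on (LAl l) limit_functional.
  move=> z f g fl gl; apply: limit_functional_lin; exact: (LAl_LA pi_neq0 (l := l)).
apply: (bounded_continuous iotaE Cc pi_neq0 (adm Ll) (HD Ll) lin (M := W)).
by move=> f fl; rewrite (limit_functionalE Ll fl) HW.
Qed.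

Lemma limit_functional_extends : extends (Pinf pi iota S) limit_functional mu.
Proof.
move=> f fP.
have [|N HN] := Pinf_locally_poly pi_neq0 pi_lt1 _ fP; first by exists L.
pose l := maxn L N.
have Ll : (L <= l)%N by rewrite leq_maxl.
have /choice[p Hp] : forall c, exists p, c \in D l ->
    locally_poly pi iota l c f p /\ (forall i, p`_i != 0 -> c <> None \/ i = 0%N).
  move=> c; case: (boolP (c \in D l)) => [cD|_]; last by exists 0.
  have [|p Hp] := HN l _ c (decomposition_centre pi_neq0 (HD Ll) cD).
    by rewrite leq_maxr.
  by exists p.
have [|_ fl fE] := locally_poly_mem (agree_closed Ll) (HD Ll) (D_uniq Ll)
  (fun c cD => (Hp c cD).1).
  by move=> c i cD nz; apply: agree_chi => //; apply: (Hp c cD).2.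
by rewrite (limit_functionalE Ll fl).
Qed.

End Inductive_limit.

Lemma extension_to_limit mu : (exists L, forall l, (L <= l)%N -> admissible l) ->
  linear_on (Pinf pi iota S) mu ->
  (exists2 nu, LA_dual pi iota S nu & extends (Pinf pi iota S) nu mu) <->
  (\forall l \near \oo, exists M : R, growth_bound pi iota (Pinf pi iota S) l mu M).
Proof.
move=> [L0 adm0] lmu; split.
  case=> nu [lnu [N _ cnu]] numu; exists (maxn N L0) => // l /=.
  rewrite geq_max => /andP[Nl L0l].
  have lnul : linear_on (LAl l) nu.
    by move=> z f g fl gl; apply: lnu; apply: (LAl_LA pi_neq0 (l := l)).
  have [M HM] := continuous_growth iotaE Cc pi_neq0 pi_lt1 (adm0 l L0l) lnul (cnu l Nl).
  by exists M; apply/growth_boundP => a j ca Pa; rewrite -numu // HM.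
case=> N _ HN; pose L := maxn N L0.
have adm l : (L <= l)%N -> admissible l by rewrite geq_max => /andP[_ /adm0].
(* Decompositions and constants are chosen for all levels at once; the default constant 0 below L
   keeps M nonnegative everywhere, so that the shells are bounded at every level. *)
have /choice[DM HDM] : forall l, exists DM : seq (P1 k) * R, 0 <= DM.2 /\ ((L <= l)%N ->
    [/\ uniq DM.1, ball_decomposition l DM.1 & forall a j, is_centre l a ->
      Pinf pi iota S (chi a l j) -> absv (mu (chi a l j)) <= DM.2 * q ^+ (l * j)]).
  move=> l; case: (leqP L l) => [Ll|_]; last by exists ([::], 0).
  have [D uD HD] := decomposition_exists pi_neq0 pi_lt1 S_compact (adm l Ll).
  have [|M /growth_boundP HM] := HN l; first by rewrite /= (leq_trans _ Ll) // leq_maxl.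
  exists (D, `|M|); split=> [|_]; [exact: normr_ge0|split=> // a j ca Pa].
  apply: le_trans (HM a j ca Pa) _; apply: ler_wpM2r; last exact: ler_norm.
  by rewrite exprn_ge0 // ltW.
pose D l := (DM l).1; pose M l := (DM l).2.
have M0 l : 0 <= M l by have [] := HDM l.
have uD l : (L <= l)%N -> uniq (D l) by move=> Ll; have [_ /(_ Ll)[]] := HDM l.
have HD l : (L <= l)%N -> ball_decomposition l (D l).
  by move=> Ll; have [_ /(_ Ll)[]] := HDM l.
have HM l : (L <= l)%N -> forall a j, is_centre l a ->
    Pinf pi iota S (chi a l j) -> absv (mu (chi a l j)) <= M l * q ^+ (l * j).
  by move=> Ll; have [_ /(_ Ll)[]] := HDM l.
have [b [bE b_le]] := mittag_leffler_telescope q0 pi_lt1 (shell_le adm HD M0 HM).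
exists (limit_functional L mu D b); last first.
  exact: (limit_functional_extends adm lmu uD HD M0 HM bE b_le).
split; first exact: (limit_functional_lin adm lmu uD HD M0 HM bE b_le).
exists L => // l Ll; exact: (limit_functional_continuous adm lmu uD HD M0 HM bE b_le).
Qed.

End Extension.

Theorem proposition4p1 (R : realType) (F : finFieldType)
    (k C : ultrametricFieldType R) (cst : {rmorphism F -> k}) (pi : k)
    (iota : {rmorphism k -> C})
    (hk : is_Laurent_series_field cst pi)
    (hC : is_completion_of_algebraic_closure iota)
    (S : set (P1 k)) (S_neq0 : S !=set0) (S_open : open S)
    (S_compact : compact S) :
  (\forall l \near \oo, forall mu : (S -> C) -> C,
     linear_on (Plinf pi iota S l) mu ->
     ((exists2 nu, LAl_dual pi iota S l nu &
         extends (Plinf pi iota S l) nu mu) <->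
      (exists M : R, growth_bound pi iota (Plinf pi iota S l) l mu M)))
  /\
  (forall mu : (S -> C) -> C,
     linear_on (Pinf pi iota S) mu ->
     ((exists2 nu, LA_dual pi iota S nu & extends (Pinf pi iota S) nu mu) <->
      (\forall l \near \oo, exists M : R,
         growth_bound pi iota (Pinf pi iota S) l mu M))).
Proof.
have [piE _ _] := hk; have [iotaE Cc _] := hC.
have F1 : (1 < #|F|)%N := card_finNzRing_gt1 F.
have pi_neq0 : pi != 0.
  by rewrite -absv_gt0 piE invr_gt0 ltr0n (ltn_trans _ F1).
have pi_lt1 : absv pi < 1 by rewrite piE invf_lt1 ?ltr0n ?ltr1n // (ltn_trans _ F1).
have [L adm] := admissible_near pi_neq0 pi_lt1 S_compact S_open.
split=> [|mu]; last by apply: extension_to_limit => //; exists L.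
exists L => // l /= Ll mu.
exact: (extension_at_level iotaE Cc pi_neq0 pi_lt1 S_compact (adm l Ll)).
Qed.
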